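(* Let $X$ be an infinite dimensional complex Banach space, let $T\in L(X)$ and let $d=\mathrm{dis}(T)$. Suppose that $T$ is an upper semi-B-Fredholm (resp. a lower semi-B-Fredholm) operator such that $\mathcal R(T)+\mathcal N(T^d)$ (resp. $\mathcal R(T^d)\cap\mathcal N(T)$) has a complementary subspace in $X$. Then $T$ is pseudo semi-B-Fredholm and $\mathrm{ind}(T)=\mathrm{ind}(T_{[n]})$, where $n$ is any integer such that $\mathcal R(T^n)$ is closed and $T_{[n]}$ is semi-Fredholm, and $\mathrm{ind}(T)$ is the index of $T$ as a pseudo semi-B-Fredholm operator.
   Context: For a bounded operator $S$ on a Banach space $Y$, with kernel $\mathcal N(S)$ and range $\mathcal R(S)$: $S$ is upper semi-Fredholm if $\mathcal R(S)$ is closed and $\dim\mathcal N(S)<\infty$; lower semi-Fredholm if $\mathrm{codim}\,\mathcal R(S)<\infty$; semi-Fredholm if it is upper or lower semi-Fredholm, and then $\mathrm{ind}(S)=\dim\mathcal N(S)-\mathrm{codim}\,\mathcal R(S)\in\mathbb Z\cup\{\pm\infty\}$. $S$ is quasi-nilpotent if $0$ is the only point of its spectrum. $L(X)$ is the algebra of bounded operators on $X$. For $n\in\mathbb N$ (including $0$), $T_{[n]}:\mathcal R(T^n)\to\mathcal R(T^n)$ is the restriction of $T$. $T$ is upper (resp. lower) semi-B-Fredholm if for some integer $n\ge0$ the range $\mathcal R(T^n)$ is closed and $T_{[n]}$ is upper (resp. lower) semi-Fredholm. The degree of stable iteration is $\mathrm{dis}(T)=\inf\{m\in\mathbb N:\mathcal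 R(T^m)\cap\mathcal N(T)=\mathcal R(T^r)\cap\mathcal N(T)\ \text{for all integers } r\ge m\}$, with $\inf\emptyset=\infty$ (it is finite for semi-B-Fredholm operators). A subspace $Z$ of $X$ has a complementary subspace in $X$ if it is topologically complemented: there is a closed subspace $W$ with $X=Z\oplus W$ (the subspaces $Z$ in question are closed). $(M,N)\in Red(T)$ means that $M,N$ are closed $T$-invariant subspaces with $X=M\oplus N$ (so $M\cap N=\{0\}$); $T_M$ denotes the restriction of $T$ to $M$. The zero subspace is allowed; the operator on $\{0\}$ is regarded as quasi-nilpotent and Fredholm of index $0$. $T$ is pseudo semi-B-Fredholm if there exists $(M,N)\in Red(T)$ such that $T_M$ is semi-Fredholm and $T_N$ is quasi-nilpotent; its index as a pseudo semi-B-Fredholm operator is $\mathrm{ind}(T):=\mathrm{ind}(T_M)$, independent of the choice of such $(M,N)$. *)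

(* Defs.v *)
From HB Require Import structures.
From mathcomp Require Import all_boot all_order all_algebra.
From mathcomp Require Import complex.
From mathcomp Require Import all_classical all_reals all_analysis.

Set Implicit Arguments.
Unset Strict Implicit.
Unset Printing Implicit Defensive.

Import Order.TTheory GRing.Theory Num.Theory.
Import numFieldNormedType.Exports.

Local Open Scope classical_set_scope.
Local Open Scope ring_scope.

(* A linear subspace of X is a [submodClosed X]; [subspace_of L] is L seen as a
   normed space of its own, with the norm (hence the topology) inherited from
   X. *)
Record subspace_of (K : pzRingType) (X : lmodType K) (L : submodClosed X) :=
  SubspaceOf { sub_val :> X; sub_valP : sub_val \in L }.

Section SubspaceInstances.
Context {K : pzRingType} {X : lmodType K} (L : submodClosed X).

HB.instance Definition _ := [isSub of subspace_of L for @sub_val K X L].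
HB.instance Definition _ := [Choice of subspace_of L by <:].
HB.instance Definition _ := [SubChoice_isSubLmodule of subspace_of L by <:].

End SubspaceInstances.

Section NormedSubspace.
Context {K : numFieldType} {X : normedModType K} (L : submodClosed X).

Let norm (u : subspace_of L) : K := `|val u|.

Let ler_normD u v : norm (u + v) <= norm u + norm v.
Proof. by rewrite /norm raddfD ler_normD. Qed.

Let normrZ (a : K) u : norm (a *: u) = `|a| * norm u.
Proof. by rewrite /norm linearZ normrZ. Qed.

Let normr0_eq0 u : norm u = 0 -> u = 0.
Proof. by move=> /normr0_eq0 u0; apply: val_inj; rewrite u0 raddf0. Qed.

HB.instance Definition _ :=
  Lmodule_isNormed.Build K (subspace_of L) ler_normD normrZ normr0_eq0.

End NormedSubspace.

Record invariant_subspace (K : pzRingType) (X : lmodType K)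
    (T : {linear X -> X}) := InvariantSubspace {
  inv_sub :> submodClosed X;
  inv_subP : {homo T : x / x \in inv_sub} }.

Section Restriction.
Context {K : pzRingType} {X : lmodType K} (T : {linear X -> X}).

Definition restrict (M : invariant_subspace T) (u : subspace_of M) :
  subspace_of M := SubspaceOf (inv_subP (sub_valP u)).

Fact restrict_is_linear (M : invariant_subspace T) : linear (@restrict M).
Proof. by move=> a u v; apply: val_inj; rewrite /= !linearP. Qed.

HB.instance Definition _ (M : invariant_subspace T) :=
  GRing.isLinear.Build K (subspace_of M) (subspace_of M) *:%R (@restrict M)
    (@restrict_is_linear M).

Definition range_iter (n : nat) : {pred X} :=
  fun x => `[< range (iter n T) x >].

Fact range_iter_submod_closed n : submod_closed (range_iter n).
Proof.
have itP a u v : iter n T (a *: u + v) = a *: iter n T u + iter n T v.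
  by elim: n => //= n ->; rewrite linearP.
split=> [|a u v /asboolP[x _ <-] /asboolP[y _ <-]]; apply/asboolP.
  by exists 0 => //; elim: n {itP} => //= n ->; rewrite raddf0.
by exists (a *: x + y).
Qed.

HB.instance Definition _ n :=
  GRing.isSubmodClosed.Build K X (range_iter n) (range_iter_submod_closed n).

Fact range_iter_invariant n : {homo T : x / x \in range_iter n}.
Proof.
move=> x /asboolP[y _ <-]; apply/asboolP; exists (T y) => //.
by rewrite -iterS -iterSr.
Qed.

Definition range_iter_sub n : invariant_subspace T :=
  InvariantSubspace (@range_iter_invariant n).

(* T_[n], the restriction of T to the range of T^n *)
Definition restrict_range n : {linear subspace_of (range_iter_sub n) ->
                                      subspace_of (range_iter_sub n)} :=
  @restrict (range_iter_sub n).

End Restriction.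

Section Dimension.
Context {K : pzRingType} {X : lmodType K}.
Implicit Types A B : set X.

(* the classes of e_0, ..., e_{n-1} form a basis of A / (A `&` B) *)
Definition has_qdim A B (n : nat) := exists e : 'I_n -> X,
  (forall i, A (e i)) /\
  forall x, A x -> exists! c : {ffun 'I_n -> K}, B (x - \sum_i c i *: e i).

Definition qdim A B : \bar int :=
  if pselect (exists n, has_qdim A B n) is left h then (projT1 (cid h))%:Z%:E
  else +oo%E.

Definition subspace_dim A : \bar int := qdim A [set 0].
Definition subspace_codim B : \bar int := qdim setT B.

End Dimension.

Section Operators.
Context {K : numFieldType} {Y : normedModType K}.
Implicit Types S B : {linear Y -> Y}.

Definition bounded_operator S :=
  exists M : K, forall y, `|S y| <= M * `|y|.

Definition null_space (f : Y -> Y) : set Y := f @^-1` [set 0].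

Definition upper_semi_Fredholm S :=
  closed (range S) /\ (subspace_dim (null_space S) < +oo)%E.

Definition lower_semi_Fredholm S := (subspace_codim (range S) < +oo)%E.

Definition semi_Fredholm S := upper_semi_Fredholm S \/ lower_semi_Fredholm S.

(* Meaningful for semi-Fredholm S only, where +oo - +oo does not occur. *)
Definition fredholm_index S : \bar int :=
  (subspace_dim (null_space S) - subspace_codim (range S))%E.

Definition spectrum S : set K := [set l | ~ exists B,
  [/\ bounded_operator B,
      forall y, B (S y - l *: y) = y &
      forall y, S (B y) - l *: B y = y]].

(* The spectrum is empty on the zero space, where the operator is nevertheless
   regarded as quasi-nilpotent. *)
Definition quasi_nilpotent S :=
  spectrum S = [set 0] \/ (forall y : Y, y = 0).

End Operators.

Section BFredholm.
Context {K : numFieldType} {X : normedModType K} (T : {linear X -> X}).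

Definition upper_semi_B_Fredholm := exists n : nat,
  closed (range (iter n T)) /\ upper_semi_Fredholm (restrict_range T n).

Definition lower_semi_B_Fredholm := exists n : nat,
  closed (range (iter n T)) /\ lower_semi_Fredholm (restrict_range T n).

Definition stable_iteration (m : nat) := forall r : nat, (m <= r)%N ->
  range (iter m T) `&` null_space T = range (iter r T) `&` null_space T.

Fact ex_stable_iteration :
  (exists m, stable_iteration m) -> exists m, `[< stable_iteration m >].
Proof. by move=> [m /asboolP]; exists m. Qed.

(* [None] stands for the infinite degree. *)
Definition dis : option nat :=
  if pselect (exists m, stable_iteration m) is left h
  then Some (ex_minn (ex_stable_iteration h)) else None.

Definition sum_set (A B : set X) : set X := [set a + b | a in A & b in B].

Definition direct_sum (A B : set X) :=
  A `&` B = [set 0] /\ sum_set A B = setT.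

Definition complemented (Z : set X) := exists W : submodClosed X,
  closed [set` W] /\ direct_sum Z [set` W].

Definition Red (M N : invariant_subspace T) :=
  [/\ closed [set` M], closed [set` N] & direct_sum [set` M] [set` N]].

Definition pseudo_decomposition (M N : invariant_subspace T) :=
  [/\ Red M N, semi_Fredholm (@restrict K X T M)
    & quasi_nilpotent (@restrict K X T N)].

Definition pseudo_semi_B_Fredholm :=
  exists M N : invariant_subspace T, pseudo_decomposition M N.

(* "The index of T as a pseudo semi-B-Fredholm operator is k": the index does
   not depend on the decomposition, so every decomposition must yield k. *)
Definition has_pseudo_index (k : \bar int) :=
  forall M N : invariant_subspace T, pseudo_decomposition M N ->
    fredholm_index (@restrict K X T M) = k.

End BFredholm.

(* Main.v *)
Require Import Defs.
From HB Require Import structures.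
From mathcomp Require Import all_boot all_order all_algebra.
From mathcomp Require Import complex.
From mathcomp Require Import zify lra.
From mathcomp Require Import all_classical all_reals all_analysis.
Import Order.TTheory GRing.Theory Num.Theory.
Import numFieldNormedType.Exports.
Local Open Scope classical_set_scope.
Local Open Scope ring_scope.
Set Implicit Arguments.
Unset Strict Implicit.
Unset Printing Implicit Defensive.

(** Let [V = R(T) + N(T^d)] and [K = R(T^d) /\ N(T)], and let [W] and [Z] be
    closed complements of [V] and of [K]. One of them is given; the other one
    exists because the semi-B-Fredholm hypothesis makes [K] finite-dimensional
    (and then Hahn-Banach applies, [fin_dim_complement]) or [V] of finite
    codimension ([fin_codim_complement]).

    Existence. The Kato decomposition of [T] is written down from [W] and [Z]:
<<
      M = W + T W + ... + T^(d-1) W + T^d X,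
      N = { x | T^d x = 0 and T^i x lies in Z for all i < d }.
>>
    Stability of the kernels from [d] on gives, by algebra alone,
    [X = M (+) N], [M = W (+) T M], [N(T) /\ M = K] and
    [M / T M = X / V] ([core_nil_sum], [core_nil_disjoint], [core_split],
    [core_kernel], [core_coker]). Here [N] is closed because [Z] is, while [M]
    and [T M] are closed because each is the image of a Banach space and has a
    closed complement ([closed_summand], a form of the open mapping theorem).
    So [T] restricted to [M] is semi-Fredholm, and it is nilpotent on [N].

    Index. Passing from [T : A -> A] to its restriction to [T A] takes the same
    number away from the dimensions of the kernel and of the cokernel
    ([ker_coker_step]), so that the index does not change ([index_step]). Given
    any decomposition [(M, N)] it is therefore enough to find [p >= n] such that
    [T] is bijective on [T^p N]: then [T] has the same kernel and cokernel on
    [T^p X] as on [T^p M]. On [A = T^n N] the operator is semi-Fredholm and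
    [T - l] is bijective for every nonzero [l]. This already makes [T] bijective
    on some [T^m A] ([semi_Fredholm_bijective]): once the kernels are stable, a
    kernel vector [x_0] starts a backward orbit [x_0, x_1, ...] of geometric
    growth, and [\sum_k l^k x_k] would be an eigenvector for each small [l]; and an
    injective [T] with closed range which is a limit of the surjective [T - l]
    is itself surjective. *)

(** * Subspaces and relative dimensions *)

Section Subspaces.
Context {K : fieldType} {X : lmodType K}.
Implicit Types A B C : set X.

Definition subspace A := A 0 /\ forall a u v, A u -> A v -> A (a *: u + v).

Lemma subspace0 A : subspace A -> A 0. Proof. by case. Qed.

Lemma subspaceD A : subspace A -> forall u v, A u -> A v -> A (u + v).
Proof. by move=> [_ h] u v Au Av; rewrite -[u]scale1r; exact: h. Qed.

Lemma subspaceZ A : subspace A -> forall a u, A u -> A (a *: u).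
Proof. by move=> [h0 h] a u Au; rewrite -[_ *: _]addr0; exact: h. Qed.

Lemma subspaceN A : subspace A -> forall u, A u -> A (- u).
Proof. by move=> hA u Au; rewrite -scaleN1r; exact: subspaceZ. Qed.

Lemma subspaceB A : subspace A -> forall u v, A u -> A v -> A (u - v).
Proof. by move=> hA u v Au Av; apply: subspaceD => //; exact: subspaceN. Qed.

Lemma subspace_sum A : subspace A -> forall n (f : 'I_n -> X),
  (forall i, A (f i)) -> A (\sum_i f i).
Proof.
by move=> hA n f hf; apply: big_ind => //; [exact: subspace0|exact: subspaceD].
Qed.

Lemma subspaceT : subspace [set: X]. Proof. by []. Qed.

Lemma subspace_zero : subspace [set 0 : X].
Proof. by split=> // a u v /= -> ->; rewrite scaler0 addr0. Qed.

Lemma subspaceI A B : subspace A -> subspace B -> subspace (A `&` B).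
Proof.
by move=> [A0 hA] [B0 hB]; split=> // a u v [] ? ? [] ? ?; split; [exact: hA|exact: hB].
Qed.

Lemma subspace_pred (L : submodClosed X) : subspace [set` L].
Proof. by split=> [|a u v uL vL]; [exact: rpred0|exact: rpredD (rpredZ _ _) _]. Qed.

Lemma subspace_span n (e : 'I_n -> X) :
  subspace [set \sum_i c i *: e i | c in [set: {ffun 'I_n -> K}]].
Proof.
split; first by exists 0 => //; rewrite big1 // => i _; rewrite ffunE scale0r.
move=> a _ _ [c _ <-] [c' _ <-]; exists [ffun i => a * c i + c' i] => //.
by rewrite scaler_sumr -big_split; apply: eq_bigr => i _; rewrite ffunE scalerDl scalerA.
Qed.

End Subspaces.

Lemma subspace_add (K : numFieldType) (X : normedModType K) (A B : set X) :
  subspace A -> subspace B -> subspace (sum_set A B).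
Proof.
move=> hA hB; split.
  by exists 0; [exact: subspace0|exists 0; [exact: subspace0|rewrite addr0]].
move=> a _ _ [x Ax [y By <-]] [x' Ax' [y' By' <-]].
exists (a *: x + x'); first exact: hA.2.
by exists (a *: y + y'); [exact: hB.2|rewrite scalerDr addrACA].
Qed.

Section SubspaceMaps.
Context {K : fieldType} {X Y : lmodType K} (f : {linear X -> Y}).

Lemma subspace_image (A : set X) : subspace A -> subspace (f @` A).
Proof.
move=> [A0 hA]; split; first by exists 0 => //; rewrite linear0.
by move=> a _ _ [u Au <-] [v Av <-]; exists (a *: u + v); [exact: hA|rewrite linearP].
Qed.

Lemma subspace_preimage (A : set Y) : subspace A -> subspace (f @^-1` A).
Proof.
move=> [A0 hA]; split; rewrite /preimage /=; first by rewrite linear0.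
by move=> a u v Au Av; rewrite linearP; exact: hA.
Qed.

End SubspaceMaps.

Section RelativeDimension.
Context {K : fieldType} {X : lmodType K}.
Implicit Types A B C : set X.

Definition free_mod B n (e : 'I_n -> X) :=
  forall c : {ffun 'I_n -> K}, B (\sum_i c i *: e i) -> c = 0.

Lemma has_qdimP A B n : subspace A -> subspace B ->
  has_qdim A B n <-> exists e : 'I_n -> X, [/\ forall i, A (e i), free_mod B e &
    forall x, A x -> exists c : {ffun 'I_n -> K}, B (x - \sum_i c i *: e i)].
Proof.
move=> hA hB; split=> -[e].
  move=> [Ae he]; exists e; split=> //; last by move=> x /he[c [Bc _]]; exists c.
  move=> c Bc; have [c0 [Bc0 uni]] := he _ (subspace0 hA).
  have c00 : c0 = 0.
    by apply: uni; rewrite big1 ?subr0; [exact: subspace0|move=> i _; rewrite ffunE scale0r].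
  suff /ffunP h : c0 = [ffun i => - c i].
    by apply/ffunP => i; have := h i; rewrite c00 !ffunE => /esym/eqP; rewrite oppr_eq0 => /eqP.
  apply: uni; rewrite sub0r -sumrN; under eq_bigr do rewrite ffunE scaleNr opprK.
  exact: Bc.
move=> [Ae fe se]; exists e; split=> // x Ax.
have [c Bc] := se _ Ax; exists c; split=> // c' Bc'.
apply/eqP; rewrite -subr_eq0; apply/eqP/fe.
have := subspaceB hB Bc' Bc; rewrite opprB addrC addrA subrK -sumrB.
by congr B; apply: eq_bigr => i _; rewrite !ffunE scalerBl.
Qed.

(** The matrix of coordinates has more rows than columns, and a nonzero vector
    of its row kernel is a linear relation. *)
Lemma dependent_family B n m (e : 'I_n -> X) (f : 'I_m -> X) :
  subspace B -> (n < m)%N ->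
  (forall j, exists c : {ffun 'I_n -> K}, B (f j - \sum_i c i *: e i)) ->
  ~ free_mod B f.
Proof.
move=> hB nm /choice[c Bc] fr.
pose M : 'M[K]_(m, n) := \matrix_(j, i) c j i.
have : kermx M != 0.
  rewrite kermx_eq0 /row_free; apply/eqP => rk.
  by have := rank_leq_col M; rewrite rk leqNgt nm.
move=> /rowV0Pn[v vM vn0]; case/negP: vn0; apply/eqP/rowP => j; rewrite mxE.
have {}vM : v *m M = 0 by apply/sub_kermxP.
suff /ffunP/(_ j) : [ffun j => v 0 j] = 0 :> {ffun 'I_m -> K} by rewrite !ffunE.
apply: fr.
have -> : \sum_i [ffun j => v 0 j] i *: f i =
    \sum_i v 0 i *: (f i - \sum_k c i k *: e k) + \sum_i v 0 i *: \sum_k c i k *: e k.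
  by rewrite -big_split; apply: eq_bigr => i _; rewrite ffunE /= -scalerDr subrK.
rewrite [X in _ + X](_ : _ = 0) ?addr0; last first.
  under eq_bigr do rewrite scaler_sumr.
  rewrite exchange_big big1 //= => k _.
  under eq_bigr do rewrite scalerA.
  rewrite -scaler_suml; have /rowP/(_ k) := vM; rewrite !mxE => h.
  by rewrite [X in X *: _](_ : _ = 0) ?scale0r // -[RHS]h; apply: eq_bigr => i _; rewrite mxE.
by apply: subspace_sum => // i; apply: subspaceZ.
Qed.

Lemma has_qdim_inj A B n m : subspace A -> subspace B ->
  has_qdim A B n -> has_qdim A B m -> n = m.
Proof.
move=> hA hB /(has_qdimP _ hA hB)[e [Ae fe se]] /(has_qdimP _ hA hB)[f [Af ff sf]].
apply/eqP; rewrite eqn_leq; apply/andP; split; rewrite leqNgt; apply/negP => lt.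
  by apply: (dependent_family hB lt _ fe) => j; apply: sf.
by apply: (dependent_family hB lt _ ff) => j; apply: se.
Qed.

Lemma qdimE A B n : subspace A -> subspace B -> has_qdim A B n -> qdim A B = n%:Z%:E.
Proof.
move=> hA hB h; rewrite /qdim; case: pselect => [h'|]; last by case; exists n.
by case: cid => m /= hm; rewrite (has_qdim_inj hA hB hm h).
Qed.

Lemma qdim_oo A B : ~ (exists n, has_qdim A B n) -> qdim A B = +oo%E.
Proof. by move=> h; rewrite /qdim; case: pselect. Qed.

Lemma qdim_fin A B : (qdim A B < +oo)%E -> exists n, has_qdim A B n.
Proof. by move=> h; apply: contrapT => /qdim_oo qE; rewrite qE in h. Qed.

(** A maximal family of vectors of [A] free modulo [B] is a basis of [A] modulo
    [B]. *)
Lemma has_qdim_bounded A B n : subspace A -> subspace B ->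
  (forall m (f : 'I_m -> X), (forall j, A (f j)) -> free_mod B f -> (m <= n)%N) ->
  exists m, has_qdim A B m.
Proof.
move=> hA hB bnd.
pose P m := `[< exists f : 'I_m -> X, (forall j, A (f j)) /\ free_mod B f >].
have exP : exists m, P m.
  by exists 0%N; apply/asboolP; exists (fun=> 0); split=> [[]|c _] //; apply/ffunP => -[].
have bP m : P m -> (m <= n)%N by move=> /asboolP[f [? ?]]; apply: (bnd _ f).
case: (ex_maxnP exP bP) => m /asboolP[e [Ae fe]] maxm; exists m.
apply/has_qdimP => //; exists e; split=> // x Ax; apply: contrapT => nx.
suff /maxm : P m.+1 by rewrite ltnn.
apply/asboolP; exists (fun i => if unlift ord0 i is Some j then e j else x).
split=> [i|c]; first by case: unliftP => [j _|_].
rewrite big_ord_recl unlift_none.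
under eq_bigr do rewrite liftK.
have [c0 Bc|c0 Bc] := eqVneq (c ord0) 0.
  rewrite c0 scale0r add0r in Bc.
  have /ffunP ce : [ffun i => c (lift ord0 i)] = 0 :> {ffun 'I_m -> K}.
    by apply: fe; under eq_bigr do rewrite ffunE.
  apply/ffunP => i; rewrite ffunE; case: (unliftP ord0 i) => [j ->|->] //.
  by have := ce j; rewrite !ffunE.
case: nx; exists [ffun i => - (c ord0)^-1 * c (lift ord0 i)].
have := subspaceZ hB (c ord0)^-1 Bc; rewrite scalerDr scalerA mulVf // scale1r.
congr B; congr (_ + _); rewrite scaler_sumr -sumrN; apply: eq_bigr => i _.
by rewrite ffunE scalerA mulNr scaleNr opprK.
Qed.

Lemma has_qdim_free_le A B n m (f : 'I_m -> X) : subspace A -> subspace B ->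
  has_qdim A B n -> (forall j, A (f j)) -> free_mod B f -> (m <= n)%N.
Proof.
move=> hA hB /(has_qdimP _ hA hB)[e [_ _ se]] Af ff; rewrite leqNgt; apply/negP => lt.
by apply: (dependent_family hB lt _ ff) => j; apply: se.
Qed.

Lemma has_qdim_sub A A' B B' n : subspace A -> subspace A' -> subspace B -> subspace B' ->
  A' `<=` A -> B `<=` B' -> has_qdim A B n -> exists m, has_qdim A' B' m.
Proof.
move=> hA hA' hB hB' AA BB h; apply: (@has_qdim_bounded _ _ n) => // m f Af ff.
apply: (has_qdim_free_le hA hB h (f := f)) => [j|c /BB]; [exact: AA|exact: ff].
Qed.

Lemma has_qdimD A B C n m : subspace A -> subspace B -> subspace C ->
  B `<=` A -> C `<=` B ->
  has_qdim A B n -> has_qdim B C m -> has_qdim A C (n + m).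
Proof.
move=> hA hB hC BA CB /(has_qdimP _ hA hB)[e [Ae fe se]] /(has_qdimP _ hB hC)[f [Bf ff sf]].
apply/has_qdimP => //.
exists (fun i : 'I_(n + m) => match fintype.split i with inl j => e j | inr j => f j end).
have sumE (c : {ffun 'I_(n + m) -> K}) :
  \sum_i c i *: (match fintype.split i with inl j => e j | inr j => f j end) =
  \sum_i c (lshift m i) *: e i + \sum_i c (rshift n i) *: f i.
  rewrite big_split_ord; congr (_ + _); apply: eq_bigr => i _ /=.
    by rewrite (unsplitK (inl i)).
  by rewrite (unsplitK (inr i)).
split=> [i|c|x Ax].
- by case: (fintype.split i) => j //; apply: BA.
- rewrite sumE => Cc.
  have Bf2 : B (\sum_i c (rshift n i) *: f i).
    by apply: subspace_sum => // i; apply: subspaceZ.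
  have /ffunP c1 : [ffun i => c (lshift m i)] = 0 :> {ffun 'I_n -> K}.
    apply: fe; under eq_bigr do rewrite ffunE.
    rewrite -[X in B X](addrK (\sum_i c (rshift n i) *: f i)).
    by apply: subspaceB => //; apply: CB.
  have /ffunP c2 : [ffun i => c (rshift n i)] = 0 :> {ffun 'I_m -> K}.
    apply: ff; under eq_bigr do rewrite ffunE.
    move: Cc; rewrite big1 ?add0r // => i _.
    by have := c1 i; rewrite !ffunE => ->; rewrite scale0r.
  apply/ffunP => i; rewrite ffunE -(splitK i); case: (fintype.split i) => j /=.
    by have := c1 j; rewrite !ffunE.
  by have := c2 j; rewrite !ffunE.
- have [c Bc] := se _ Ax; have [c' Cc'] := sf _ Bc.
  exists [ffun i : 'I_(n + m) => match fintype.split i with inl j => c j | inr j => c' j end].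
  move: Cc'; rewrite -addrA -opprD sumE; congr (C (_ - (_ + _))); apply: eq_bigr => i _.
    by rewrite ffunE (unsplitK (inl i)).
  by rewrite ffunE (unsplitK (inr i)).
Qed.

Lemma qdimD A B C : subspace A -> subspace B -> subspace C ->
  B `<=` A -> C `<=` B -> qdim A C = (qdim A B + qdim B C)%E.
Proof.
move=> hA hB hC BA CB.
have [[n hn]|h1] := pselect (exists n, has_qdim A B n); last first.
  rewrite (qdim_oo h1) [LHS]qdim_oo => [|[n h]].
    by rewrite /qdim; case: pselect.
  by apply: h1; apply: has_qdim_sub h.
have [[m hm]|h2] := pselect (exists n, has_qdim B C n); last first.
  rewrite (qdim_oo h2) [LHS]qdim_oo => [|[k h]].
    by rewrite (qdimE hA hB hn).
  by apply: h2; apply: has_qdim_sub h.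
have hnm := has_qdimD hA hB hC BA CB hn hm.
by rewrite (qdimE hA hB hn) (qdimE hB hC hm) (qdimE hA hC hnm) PoszD.
Qed.

Lemma qdim_natoo A B : subspace A -> subspace B ->
  (exists n : nat, qdim A B = n%:Z%:E) \/ qdim A B = +oo%E.
Proof.
move=> hA hB; have [[n hn]|h] := pselect (exists n, has_qdim A B n).
  by left; exists n; rewrite (qdimE hA hB hn).
by right; apply: qdim_oo.
Qed.

Lemma qdim0_sub A B : subspace A -> subspace B -> qdim A B = 0%E -> A `<=` B.
Proof.
move=> hA hB q0; have /qdim_fin[n hn] : (qdim A B < +oo)%E by rewrite q0.
move: q0; rewrite (qdimE hA hB hn) => -[n0]; rewrite n0 in hn.
move=> x Ax; have /(has_qdimP _ hA hB)[e [_ _ /(_ _ Ax)[c]]] := hn.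
by rewrite big_ord0 subr0.
Qed.

End RelativeDimension.

Section Transfer.
Context {K : fieldType} {X Y : lmodType K} (f : {linear X -> Y}).


(** The three hypotheses on [f] say that it is well defined, injective and
    surjective as a map [A / B -> A' / B']. *)
Lemma qdim_iso A B A' B' :
  subspace A -> subspace B -> subspace A' -> subspace B' ->
  (forall x, A x -> A' (f x)) -> (forall x, A x -> B' (f x) <-> B x) ->
  (forall y, A' y -> exists2 x, A x & B' (y - f x)) ->
  qdim A B = qdim A' B'.
Proof.
move=> hA hB hA' hB' fA fB fs.
have fsum n (c : {ffun 'I_n -> K}) (e : 'I_n -> X) :
    f (\sum_i c i *: e i) = \sum_i c i *: f (e i).
  by rewrite linear_sum; apply: eq_bigr => i _; rewrite linearZ.
have to n : has_qdim A B n -> has_qdim A' B' n.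
  move=> /(has_qdimP _ hA hB)[e [Ae fe se]]; apply/has_qdimP => //.
  exists (f \o e); split=> [i|c|y Ay]; first exact/fA/Ae.
    rewrite /= -fsum => Bc; apply: fe; apply/fB => //.
    by apply: subspace_sum => // i; apply: subspaceZ.
  have [x Ax Byx] := fs _ Ay; have [c Bc] := se _ Ax; exists c.
  rewrite /= -fsum -[y](subrK (f x)) -addrA -linearB; apply: subspaceD => //.
  by apply/fB => //; apply: subspaceB => //; apply: subspace_sum => // i; apply: subspaceZ.
have from n : has_qdim A' B' n -> has_qdim A B n.
  move=> /(has_qdimP _ hA' hB')[e [Ae fe se]]; apply/has_qdimP => //.
  have /choice[g gP] : forall i, exists x, A x /\ B' (e i - f x).
    by move=> i; have [x] := fs _ (Ae i); exists x.
  have Bge (c : {ffun 'I_n -> K}) : B' (\sum_i c i *: e i - \sum_i c i *: f (g i)).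
    rewrite -sumrB; apply: subspace_sum => // i.
    by rewrite -scalerBr; apply: subspaceZ => //; case: (gP i).
  have Ag (c : {ffun 'I_n -> K}) : A (\sum_i c i *: g i).
    by apply: subspace_sum => // i; apply: subspaceZ => //; case: (gP i).
  exists g; split=> [i|c Bc|x Ax]; first by case: (gP i).
    apply: fe; rewrite -[X in B' X](subrK (\sum_i c i *: f (g i))).
    by apply: subspaceD => //; rewrite -fsum; apply/fB.
  have [c Bc] := se _ (fA _ Ax); exists c.
  apply/fB; first exact: subspaceB.
  rewrite linearB fsum -[f x](subrK (\sum_i c i *: e i)) -addrA.
  exact: subspaceD.
have [[n hn]|h] := pselect (exists n, has_qdim A B n).
  by rewrite (qdimE hA hB hn) (qdimE hA' hB' (to _ hn)).
by rewrite !qdim_oo // => -[n /from hn]; apply: h; exists n.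
Qed.

End Transfer.
(** * The index along the ranges of the iterates *)

Section IndexAlongRanges.
Context {K : numFieldType} {X : normedModType K} (T : {linear X -> X}).
Implicit Types A : set X.

Definition ker_dim A : \bar int := qdim (A `&` null_space T) [set 0].
Definition coker_dim A : \bar int := qdim A (T @` A).
Definition semi_fin A := (ker_dim A < +oo)%E \/ (coker_dim A < +oo)%E.

Lemma subspace_null : subspace (null_space T).
Proof. exact/subspace_preimage/subspace_zero. Qed.

Lemma image_iterS A n : iter n.+1 T @` A = T @` (iter n T @` A).
Proof. by rewrite image_comp. Qed.

Lemma image_iterSr A n : iter n.+1 T @` A = iter n T @` (T @` A).
Proof. by rewrite image_comp; apply: eq_imagel => x _; rewrite iterSr. Qed.

Lemma subspace_image_iter A n : subspace A -> subspace (iter n T @` A).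
Proof.
move=> hA; elim: n => [|n IH]; first by rewrite image_id.
by rewrite image_iterS; exact: subspace_image.
Qed.

Lemma image_iter_subS A n : T @` A `<=` A -> iter n.+1 T @` A `<=` iter n T @` A.
Proof. by move=> TA; rewrite image_iterSr; exact: image_subset. Qed.

Lemma image_iter_sub A n m : T @` A `<=` A -> (n <= m)%N ->
  iter m T @` A `<=` iter n T @` A.
Proof.
move=> TA /subnK <-; elim: (m - n)%N => //= k IH.
by rewrite addSn; apply: subset_trans IH; exact: image_iter_subS.
Qed.

(** What the kernel loses in passing from [A] to [T A], the cokernel loses too: [T]
    maps [A / (T A + ker T)] isomorphically onto [T A / T^2 A],
    and [(T A + ker T) / T A] is [ker T / (ker T /\ T A)]. *)
Lemma ker_coker_step A : subspace A -> T @` A `<=` A ->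
  let g := qdim (A `&` null_space T) (T @` A `&` null_space T) in
  ker_dim A = (g + ker_dim (T @` A))%E /\ coker_dim A = (coker_dim (T @` A) + g)%E.
Proof.
move=> hA TA g; pose TT := T @` A.
have hTA : subspace TT by exact: subspace_image.
have hN := subspace_null.
have hK : subspace (A `&` null_space T) by exact: subspaceI.
have hK' : subspace (TT `&` null_space T) by exact: subspaceI.
split.
  apply: qdimD => //; first exact: subspace_zero; first exact: setSI.
  by move=> _ ->; exact: subspace0.
pose S := sum_set TT (A `&` null_space T).
have hS : subspace S by exact: subspace_add.
have SA : S `<=` A by move=> _ [x Tx [y [Ay _] <-]]; apply: subspaceD => //; exact: TA.
have TS : TT `<=` S.
  by move=> x Tx; exists x => //; exists 0; rewrite ?addr0 //; exact: subspace0.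
rewrite /coker_dim (qdimD hA hS hTA SA TS); congr (_ + _)%E.
  apply: (qdim_iso (f := T)) => //; first exact: subspace_image.
  - by move=> x Ax; exists x.
  - move=> x Ax; split=> [[_ [a Aa <-] Tx]|[_ [a Aa <-] [k [Ak Nk] <-]]].
      exists (T a); first by exists a.
      exists (x - T a); last by rewrite addrC subrK.
      split; first by apply: subspaceB => //; apply: TA; exists a.
      by rewrite /null_space /preimage /= linearB -Tx subrr.
    exists (T a); first by exists a.
    by rewrite linearD (_ : T k = 0) ?addr0.
  - by move=> _ [x Ax <-]; exists x => //; rewrite subrr; apply: subspace0; exact: subspace_image.
apply/esym/(qdim_iso (f := idfun)) => //.
- by move=> x Kx; exists 0; [exact: subspace0|exists x; rewrite ?add0r].
- by move=> x [Ax Nx]; split=> // -[].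
- by move=> _ [x Tx [k Kk <-]]; exists k => //; rewrite addrK.
Qed.

Lemma ker_dim_natoo A : subspace A ->
  (exists n : nat, ker_dim A = n%:Z%:E) \/ ker_dim A = +oo%E.
Proof.
move=> hA; apply: qdim_natoo; last exact: subspace_zero.
by apply: subspaceI => //; exact: subspace_null.
Qed.

Lemma coker_dim_natoo A : subspace A ->
  (exists n : nat, coker_dim A = n%:Z%:E) \/ coker_dim A = +oo%E.
Proof. by move=> hA; apply: qdim_natoo => //; exact: subspace_image. Qed.

(** The loss is finite, being bounded both by the kernel and by the cokernel, so
    it cancels in the difference. *)
Lemma index_step A : subspace A -> T @` A `<=` A -> semi_fin A ->
  semi_fin (T @` A) /\
  (ker_dim A - coker_dim A = ker_dim (T @` A) - coker_dim (T @` A))%E.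
Proof.
move=> hA TA; have [] := ker_coker_step hA TA; rewrite /semi_fin.
set g := qdim _ _ => -> ->.
have hTA : subspace (T @` A) by exact: subspace_image.
have : (exists n : nat, g = n%:Z%:E) \/ g = +oo%E.
  by apply: qdim_natoo; apply: subspaceI => //; exact: subspace_null.
have [[a ->]|->] := ker_dim_natoo hTA; have [[b ->]|->] := coker_dim_natoo hTA;
  case=> [[n ->]|->] //=; rewrite ?ltry //; try by case.
- move=> _; split; first by left.
  rewrite -!EFinD; congr EFin; rewrite ?PoszD opprD [n%:Z + _]addrC addrACA.
  by rewrite subrr addr0.
Qed.

Lemma index_iter A n : subspace A -> T @` A `<=` A -> semi_fin A ->
  semi_fin (iter n T @` A) /\
  (ker_dim A - coker_dim A = ker_dim (iter n T @` A) - coker_dim (iter n T @` A))%E.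
Proof.
move=> hA TA fA; elim: n => [|n [f1 ->]]; first by rewrite image_id.
rewrite image_iterS; apply: index_step => //; first exact: subspace_image_iter.
by rewrite -image_iterS; exact: image_iter_subS.
Qed.

Lemma ker_dim_step A : subspace A -> T @` A `<=` A ->
  (ker_dim A < +oo)%E -> (ker_dim (T @` A) < +oo)%E.
Proof.
move=> hA TA; have [-> _] := ker_coker_step hA TA.
have [[n ->]|->] := ker_dim_natoo (subspace_image T hA); first by rewrite ltry.
set g := qdim _ _.
have [[k ->]|->] // : (exists n : nat, g = n%:Z%:E) \/ g = +oo%E.
apply: qdim_natoo; apply: subspaceI => //;
  [exact: subspace_null|exact: subspace_image|exact: subspace_null].
Qed.

Lemma coker_dim_step A : subspace A -> T @` A `<=` A ->
  (coker_dim A < +oo)%E -> (coker_dim (T @` A) < +oo)%E.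
Proof.
move=> hA TA; have [_ ->] := ker_coker_step hA TA.
have [[n ->]|->] := coker_dim_natoo (subspace_image T hA); first by rewrite ltry.
set g := qdim _ _.
have [[k ->]|->] // : (exists n : nat, g = n%:Z%:E) \/ g = +oo%E.
apply: qdim_natoo; apply: subspaceI => //;
  [exact: subspace_null|exact: subspace_image|exact: subspace_null].
Qed.

Lemma nonincreasing_nat_stable (v : nat -> nat) :
  (forall k, (v k.+1 <= v k)%N) -> exists m, forall r, (m <= r)%N -> v r = v m.
Proof.
move=> dv.
have dv2 m r : (m <= r)%N -> (v r <= v m)%N.
  by move=> /subnK <-; elim: (r - m)%N => //= k IH; rewrite addSn (leq_trans (dv _)).
have ex : exists n, `[< exists k, v k = n >] by exists (v 0%N); apply/asboolP; exists 0%N.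
case: (ex_minnP ex) => n /asboolP[m vm] minn; exists m => r mr.
apply/eqP; rewrite eqn_leq dv2 // vm; apply: minn; apply/asboolP; by exists r.
Qed.

(** The kernels stabilize because the dimension of the kernel (or of the
    cokernel) decreases exactly by what the kernel loses. *)
Lemma ker_stable A : subspace A -> T @` A `<=` A -> semi_fin A ->
  exists m, forall r, (m <= r)%N ->
    iter r T @` A `&` null_space T = iter m T @` A `&` null_space T.
Proof.
move=> hA TA fA.
have hAn n := subspace_image_iter n hA.
have TAn n : T @` (iter n T @` A) `<=` iter n T @` A.
  by rewrite -image_iterS; exact: image_iter_subS.
have hN := subspace_null.
pose g n := qdim (iter n T @` A `&` null_space T) (iter n.+1 T @` A `&` null_space T).
have stepn n := ker_coker_step (hAn n) (TAn n).
rewrite /= in stepn.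
suff [m hm] : exists m, forall r, (m <= r)%N -> g r = 0%E.
  exists m => r /subnK <-; elim: (r - m)%N => // k <-.
  apply/seteqP; split; first by apply: setSI; rewrite addSn; exact: image_iter_subS.
  apply: qdim0_sub; [exact: subspaceI|exact: subspaceI|].
  by rewrite addSn; apply: hm; exact: leq_addl.
have key (v : nat -> nat) (w : nat -> \bar int) : (forall n, w n = (v n)%:Z%:E) ->
    (forall n, w n = (g n + w n.+1)%E) -> exists m, forall r, (m <= r)%N -> g r = 0%E.
  move=> wv wg.
  have gv n : exists k, g n = k%:Z%:E /\ v n = (k + v n.+1)%N.
    have : (exists k : nat, g n = k%:Z%:E) \/ g n = +oo%E by apply: qdim_natoo; apply: subspaceI.
    have := wg n; rewrite !wv => + [[k gk]|gk]; rewrite gk // -EFinD => -[e].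
    by exists k; split=> //; apply/eqP; rewrite -eqz_nat e PoszD.
  have [m hm] : exists m, forall r, (m <= r)%N -> v r = v m.
    by apply: nonincreasing_nat_stable => k; have [j [_ ->]] := gv k; exact: leq_addl.
  exists m => r mr; have [k [-> e]] := gv r; congr (_%:Z%:E).
  by apply/eqP; rewrite -(eqn_add2r (v r.+1)) -e add0n !hm // (leq_trans mr).
case: fA => [fk|fc].
- have fkn n : (ker_dim (iter n T @` A) < +oo)%E.
    by elim: n => [|n IH]; rewrite ?image_id // image_iterS; exact: ker_dim_step.
  have /choice[v vP] n : exists k : nat, ker_dim (iter n T @` A) = k%:Z%:E.
    by have := fkn n; have [[k ->]|->] := ker_dim_natoo (hAn n) => //; exists k.
  apply: key vP _ => n; have [-> _] := stepn n.
  by rewrite /g -image_iterS.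
- have fcn n : (coker_dim (iter n T @` A) < +oo)%E.
    by elim: n => [|n IH]; rewrite ?image_id // image_iterS; exact: coker_dim_step.
  have /choice[v vP] n : exists k : nat, coker_dim (iter n T @` A) = k%:Z%:E.
    by have := fcn n; have [[k ->]|->] := coker_dim_natoo (hAn n) => //; exists k.
  apply: key vP _ => n; have [_ ->] := stepn n.
  by rewrite addeC /g -image_iterS.
Qed.

Lemma qdim_val (L : submodClosed X) (A B : set (subspace_of L)) (A' B' : set X) :
  subspace A -> subspace B -> subspace A' -> subspace B' ->
  A = val @^-1` A' -> B = val @^-1` B' -> A' `<=` [set` L] ->
  qdim A B = qdim A' B'.
Proof.
move=> hA hB hA' hB' eA eB LA.
apply: (qdim_iso (f := val : {linear subspace_of L -> X})) => //.
- by move=> x; rewrite eA.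
- by move=> x; rewrite eB.
- move=> y Ay; have Ly := LA _ Ay; exists (SubspaceOf Ly); first by rewrite eA.
  by rewrite subrr; exact: subspace0.
Qed.

Lemma subspace_inv (M : invariant_subspace T) : T @` [set` M] `<=` [set` M].
Proof. by move=> _ [x Mx <-]; exact: inv_subP. Qed.

Lemma ker_dim_restrict (M : invariant_subspace T) :
  subspace_dim (null_space (@Defs.restrict K X T M)) = ker_dim [set` M].
Proof.
have hM := subspace_pred M.
apply: qdim_val; first exact/(subspace_preimage (@Defs.restrict K X T M))/subspace_zero.
- exact: subspace_zero.
- by apply: subspaceI => //; exact: subspace_null.
- exact: subspace_zero.
- apply/seteqP; split=> x; rewrite /null_space /preimage /=.
    by move=> /(congr1 val) /= h; split=> //; exact: valP.
  by move=> [_ h]; apply: val_inj.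
- by apply/seteqP; split=> x; rewrite /preimage /=; [move=> ->|move=> h; apply: val_inj].
- by move=> x [].
Qed.

Lemma range_restrict (M : invariant_subspace T) :
  range (@Defs.restrict K X T M) = val @^-1` (T @` [set` M]).
Proof.
apply/seteqP; split=> [_ [x _ <-]|x [y My yx]]; first by exists (val x) => //; exact: valP.
by exists (SubspaceOf My) => //; apply: val_inj.
Qed.

Lemma coker_dim_restrict (M : invariant_subspace T) :
  subspace_codim (range (@Defs.restrict K X T M)) = coker_dim [set` M].
Proof.
have hM := subspace_pred M.
apply: qdim_val; first exact: subspaceT.
- exact/(subspace_image (@Defs.restrict K X T M))/subspaceT.
- exact: hM.
- exact: subspace_image.
- by apply/seteqP; split=> x _ //; exact: valP.
- exact: range_restrict.
- by [].
Qed.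

Lemma range_iter_set n : [set` range_iter_sub T n] = iter n T @` [set: X].
Proof. by apply/seteqP; split=> x; [move/asboolP|move=> ?; apply/asboolP]. Qed.

Lemma fredholm_index_restrict (M : invariant_subspace T) :
  fredholm_index (@Defs.restrict K X T M) = (ker_dim [set` M] - coker_dim [set` M])%E.
Proof. by rewrite /fredholm_index ker_dim_restrict coker_dim_restrict. Qed.

Lemma semi_Fredholm_fin (M : invariant_subspace T) :
  semi_Fredholm (@Defs.restrict K X T M) -> semi_fin [set` M].
Proof.
by rewrite /semi_fin -ker_dim_restrict -coker_dim_restrict => -[[_ ?]|?]; [left|right].
Qed.

Lemma dis_stable : (exists m, stable_iteration T m) -> stable_iteration T (odflt 0%N (dis T)).
Proof.
move=> h; rewrite /dis; case: pselect => // h'; rewrite /=.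
by case: ex_minnP => m /asboolP.
Qed.

End IndexAlongRanges.
(** * Real norms, closedness and completeness *)

Notation rc := (real_complex _).

Lemma ltr0c (R : realType) (r : R) : (0 < rc r :> R[i]) = (0 < r).
Proof. exact: (ltcR 0). Qed.

Section RealNorm.
Context {R : realType} {V : normedZmodType R[i]}.
Implicit Types x y : V.

Definition rnorm x : R := complex.Re `|x|.

Lemma rnormE x : `|x| = rc (rnorm x).
Proof. by rewrite /rnorm RRe_real // ger0_real. Qed.

Lemma rnorm_lt x (r : R) : (`|x| < rc r) = (rnorm x < r).
Proof. by rewrite rnormE ltcR. Qed.

Lemma rnorm_ge0 x : 0 <= rnorm x.
Proof. by have := normr_ge0 x; rewrite rnormE ler0c. Qed.

Lemma rnormD x y : rnorm (x + y) <= rnorm x + rnorm y.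
Proof. by have := ler_normD x y; rewrite !rnormE -rmorphD lecR. Qed.

Lemma rnormN x : rnorm (- x) = rnorm x.
Proof. by rewrite /rnorm normrN. Qed.

Lemma rnormB x y : rnorm (x - y) = rnorm (y - x).
Proof. by rewrite -rnormN opprB. Qed.

Lemma rnorm0 : rnorm (0 : V) = 0.
Proof. by rewrite /rnorm normr0. Qed.

Lemma rnorm_eq0 x : rnorm x = 0 -> x = 0.
Proof. by move=> h; apply/normr0_eq0; rewrite rnormE h. Qed.

Lemma rnormBD z x y : rnorm (x - y) <= rnorm (x - z) + rnorm (z - y).
Proof. by apply: le_trans (rnormD _ _); rewrite addrA subrK. Qed.

Lemma rnorm_small x : (forall e, 0 < e -> rnorm x <= e) -> x = 0.
Proof.
move=> h; apply: rnorm_eq0; apply/eqP; rewrite eq_le rnorm_ge0 andbT.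
by apply/ler_addgt0Pl => e e0; rewrite addr0; exact: h.
Qed.

End RealNorm.

Section RealNormModule.
Context {R : realType} {X : normedModType R[i]}.
Implicit Types (x y : X) (A : set X).

Lemma rnormZ (a : R[i]) x : rnorm (a *: x) = rnorm a * rnorm x.
Proof.
by have := normrZ a x; rewrite !rnormE -rmorphM => /complexI.
Qed.

Lemma rnormM (a b : R[i]) : rnorm (a * b) = rnorm a * rnorm b.
Proof. by have := normrM a b; rewrite !rnormE -rmorphM => /complexI. Qed.

Lemma rnorm_rc (r : R) : rnorm (rc r : R[i]) = `|r|.
Proof. by rewrite /rnorm normc_def /= expr0n addr0 sqrtr_sqr. Qed.

Lemma rnormZr (r : R) x : rnorm (rc r *: x) = `|r| * rnorm x.
Proof. by rewrite rnormZ rnorm_rc. Qed.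

Lemma ball_rnorm x (r : R) y : ball x (rc r) y <-> rnorm (x - y) < r.
Proof. by rewrite -ball_normE /= -rnorm_lt. Qed.

Lemma closureP A x : closure A x <->
  forall e : R, 0 < e -> exists2 a, A a & rnorm (x - a) < e.
Proof.
split=> [cA e e0|h B /nbhs_ballP[e /= e0 eB]].
  have [] := cA (ball x (rc e)); first by apply: nbhsx_ballx; rewrite ltr0c.
  by move=> a [Aa /ball_rnorm]; exists a.
have eR : rc (complex.Re e) = e by rewrite RRe_real // gtr0_real.
have [|a Aa xa] := h (complex.Re e); first by rewrite -ltr0c eR.
by exists a; split=> //; apply: eB; rewrite -eR; apply/ball_rnorm.
Qed.

Lemma closedP A : closed A <->
  forall x, (forall e : R, 0 < e -> exists2 a, A a & rnorm (x - a) < e) -> A x.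
Proof.
rewrite closure_id; split=> [cA x /closureP|h]; first by rewrite -cA.
by apply/seteqP; split; [exact: subset_closure|move=> x /closureP; exact: h].
Qed.

End RealNormModule.

Section Completeness.
Context {R : realType} {X : completeNormedModType R[i]}.

Lemma halve_le (a b : R) k : 0 <= b -> a <= b / k.+1%:R -> a / 2 <= b / k.+2%:R.
Proof.
move=> b0 ab; apply: (@le_trans _ _ (b / k.+1%:R / 2)); first by rewrite ler_wpM2r.
rewrite -mulrA ler_wpM2l // -invfM lef_pV2 ?posrE ?mulr_gt0 ?ltr0n //.
by rewrite -natrM ler_nat; lia.
Qed.

(** The only form of completeness that the proof uses. The bound [2 * r k] sums
    the geometric series of the remaining steps. *)
Lemma rapid_cvg (u : nat -> X) (r : nat -> R) :
  (forall k, r k.+1 <= r k / 2) -> (forall k, rnorm (u k.+1 - u k) <= r k) ->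
  exists x, forall k, rnorm (x - u k) <= 2 * r k.
Proof.
move=> hr hu.
have r0 k : 0 <= r k by apply: le_trans (hu k); exact: rnorm_ge0.
have uD k j : rnorm (u (k + j)%N - u k) <= 2 * r k - 2 * r (k + j)%N.
  elim: j => [|j IH]; first by rewrite addn0 !subrr rnorm0.
  rewrite addnS; apply: le_trans (rnormBD (u (k + j)%N) _ _) _.
  apply: le_trans (lerD (hu _) IH) _.
  have := hr (k + j)%N; lra.
have uB k j : (k <= j)%N -> rnorm (u j - u k) <= 2 * r k.
  move=> /subnKC <-; apply: le_trans (uD _ _) _.
  by have := r0 (k + (j - k))%N; lra.
have rn k : r k <= r 0%N / k.+1%:R.
  elim: k => [|k IH]; first by rewrite divr1.
  apply: le_trans (hr k) (halve_le _ IH); exact: r0.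
have small (e : R) : 0 < e -> exists k, 2 * r k < e.
  move=> e0; exists (Num.truncn (2 * r 0%N / e)).
  apply: le_lt_trans (ler_wpM2l _ (rn _)) _ => //.
  by rewrite mulrA ltr_pdivrMr // [e * _]mulrC -ltr_pdivrMr // truncnS_gt.
have /cauchy_cvg cu : cauchy (u @ \oo).
  apply: cauchy_exP => e /= e0.
  have eR : rc (complex.Re e) = e by rewrite RRe_real // gtr0_real.
  have [|k hk] := small (complex.Re e); first by rewrite -ltr0c eR.
  exists (u k); exists k => // j /= kj; rewrite -eR; apply/ball_rnorm.
  by rewrite rnormB; apply: le_lt_trans hk; exact: uB.
exists (lim (u @ \oo)) => k.
apply/ler_addgt0Pl => e e0.
have /cvg_ballP/(_ (rc e)) := cu; rewrite ltr0c => /(_ e0)[N _ hN].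
have := hN (maxn N k); rewrite /= leq_maxl => /(_ isT)/ball_rnorm h.
apply: le_trans (rnormBD (u (maxn N k)) _ _) _; apply: lerD; first exact: ltW.
by apply: uB; exact: leq_maxr.
Qed.

(** Baire's theorem by nested balls: if the conclusion fails, the [n]-th ball can
    be chosen disjoint from [F n], with a radius at most half the previous one,
    and the limit of the centres lies in no [F n]. *)
Lemma baire_closed (Y : set X) (F : nat -> set X) :
  closed Y -> Y !=set0 -> (forall y, Y y -> exists n, F n y) ->
  exists n y (r : R), [/\ Y y, 0 < r &
    forall x, Y x -> rnorm (x - y) < r -> closure (F n) x].
Proof.
move=> cY [y0 Yy0] YF; apply: contrapT => nF.
have step (n : nat) (y : X) (r : R) : Y y -> 0 < r -> exists z : X * R,
    [/\ Y z.1, 0 < z.2, z.2 <= r / 2, rnorm (z.1 - y) <= r &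
        forall x, rnorm (x - z.1) <= 2 * z.2 -> ~ F n x].
  move=> Yy r0; apply: contrapT => nz; apply: nF; exists n, y, r; split=> // x Yx xy.
  apply/closureP => e e0; apply: contrapT => na; apply: nz.
  (* Doubling [e / 3] stays below [e], so the ball of twice the new radius, in
     which the limit of the centres lies, still avoids [F n]. *)
  exists (x, Num.min (r / 2) (e / 3)); split=> //=.
  - by rewrite lt_min !divr_gt0.
  - by rewrite ge_min lexx.
  - exact: ltW.
  - move=> a ax Fa; apply: na; exists a => //; rewrite rnormB.
    apply: le_lt_trans ax _; apply: (@le_lt_trans _ _ (2 * (e / 3))).
      by rewrite ler_wpM2l // ge_min lexx orbT.
    lra.
have /choice[g gP] : forall p : nat * (X * R), exists z : X * R, Y p.2.1 -> 0 < p.2.2 ->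
    [/\ Y z.1, 0 < z.2, z.2 <= p.2.2 / 2, rnorm (z.1 - p.2.1) <= p.2.2 &
        forall x, rnorm (x - z.1) <= 2 * z.2 -> ~ F p.1 x].
  move=> [n [y r]] /=; have [[Yy r0]|h] := pselect (Y y /\ 0 < r).
    by have [z] := step n y r Yy r0; exists z.
  by exists (y, r) => ? ?; exfalso; apply: h.
pose fix p n : X * R := if n is k.+1 then g (k, p k) else (y0, 1).
have pP n : Y (p n).1 /\ 0 < (p n).2.
  by elim: n => [|n [IH1 IH2]] //=; have [] := gP (n, p n) IH1 IH2.
have qP n := gP (n, p n) (pP n).1 (pP n).2.
have [x xP] : exists x, forall k, rnorm (x - (p k).1) <= 2 * (p k).2.
  by apply: (@rapid_cvg (fun k => (p k).1) (fun k => (p k).2)) => k; have [] := qP k.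
have [n Fx] : exists n, F n x.
  apply: YF; move/closedP: cY; apply => e e0.
  have pn k : (p k).2 <= 1 / k.+1%:R.
    elim: k => [|k IH]; first by rewrite divr1.
    by have [_ _ h _ _] := qP k; apply: le_trans h (halve_le _ IH).
  exists (p (Num.truncn (2 / e))).1; first by case: (pP (Num.truncn (2 / e))).
  apply: le_lt_trans (xP _) _; apply: le_lt_trans (ler_wpM2l _ (pn _)) _ => //.
  by rewrite mulrA mulr1 ltr_pdivrMr // [e * _]mulrC -ltr_pdivrMr // truncnS_gt.
have [_ _ _ _ /(_ x)] := qP n; apply => //; exact: (xP n.+1).
Qed.

End Completeness.
(** * The open mapping theorem for Banach discs *)

Section Discs.
Context {R : realType} {X : completeNormedModType R[i]}.
Implicit Types (A B L Y : set X) (f : {linear X -> X}).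

Local Notation h := (2^-1 : R).

(** Discs stand for unit balls of Banach spaces continuously included in [X]:
    working with sets of [X] makes images and sums of closed subspaces
    (operator ranges) available without forming products or quotients of
    spaces. The last clause says that series [\sum_k 2^-(k+1) b_k] converge in the
    disc, uniformly in the choice of the [b_k]. *)
Definition disc B := [/\ B 0,
  (forall s t : R, `|s| + `|t| <= 1 ->
     forall x y, B x -> B y -> B (rc s *: x + rc t *: y)) &
  exists c : R, forall b : nat -> X, (forall k, B (b k)) -> exists2 s, B s &
    forall n, rnorm (s - \sum_(k < n) rc (h ^+ k.+1) *: b k) <= c * h ^+ n].

Definition spans B A :=
  B `<=` A /\ forall a, A a -> exists2 t : R, 0 <= t & exists2 b, B b & a = rc t *: b.

Definition unit_disc L : set X := [set x | L x /\ rnorm x <= 1].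

Lemma expr_half_ge0 n : 0 <= h ^+ n. Proof. by rewrite exprn_ge0. Qed.

Lemma expr_half_le1 n : h ^+ n <= 1.
Proof. by apply: exprn_ile1 => //; lra. Qed.

Lemma half_small (c e : R) : 0 < e -> exists n, c * h ^+ n < e.
Proof.
move=> e0; exists (Num.truncn (`|c| / e)).
have hn n : h ^+ n <= n.+1%:R^-1.
  rewrite exprVn lef_pV2 ?posrE ?exprn_gt0 ?ltr0n //.
  by rewrite -natrX ler_nat; exact: ltn_expl.
set n := Num.truncn _.
apply: (@le_lt_trans _ _ (`|c| / n.+1%:R)).
  apply: (@le_trans _ _ (`|c| * h ^+ n)); last by rewrite ler_wpM2l.
  by rewrite ler_wpM2r ?expr_half_ge0 // ler_norm.
by rewrite ltr_pdivrMr // [e * _]mulrC -ltr_pdivrMr // truncnS_gt.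
Qed.

Lemma disc_unit L : subspace L -> closed L -> disc (unit_disc L).
Proof.
move=> hL cL; split.
- by split; [exact: subspace0|rewrite rnorm0].
- move=> s t st x y [Lx x1] [Ly y1]; split.
    by apply: subspaceD => //; exact: subspaceZ.
  apply: le_trans (rnormD _ _) _; rewrite !rnormZr; apply: le_trans st.
  by apply: lerD; rewrite -[leRHS]mulr1; apply: ler_wpM2l.
- exists 1 => b bB.
  pose u n := \sum_(k < n) rc (h ^+ k.+1) *: b k.
  have uL n : L (u n).
    by apply: subspace_sum => // k; apply: subspaceZ => //; case: (bB k).
  have u1 n : rnorm (u n) <= 1 - h ^+ n.
    elim: n => [|n IH]; first by rewrite /u big_ord0 rnorm0 subrr.
    rewrite /u big_ord_recr /=; apply: le_trans (rnormD _ _) _.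
    rewrite rnormZr ger0_norm ?expr_half_ge0 //.
    have : h ^+ n.+1 * rnorm (b n) <= h ^+ n.+1.
      by rewrite -[leRHS]mulr1 ler_wpM2l ?expr_half_ge0 //; case: (bB n).
    have := IH; rewrite /u => ?; rewrite exprS; lra.
  have [s sP] : exists s, forall n, rnorm (s - u n) <= 2 * h ^+ n.+1.
    apply: (@rapid_cvg _ _ u (fun n => h ^+ n.+1)) => n; first by rewrite [in leLHS]exprSr.
    rewrite /u big_ord_recr /= addrAC subrr add0r rnormZr ger0_norm ?expr_half_ge0 //.
    by rewrite -[leRHS]mulr1 ler_wpM2l ?expr_half_ge0 //; case: (bB n).
  have sP' n : rnorm (s - u n) <= h ^+ n.
    by apply: le_trans (sP n) _; rewrite exprS mulrA divff ?mul1r.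
  exists s; last by move=> n; rewrite mul1r; exact: sP'.
  split.
    move/closedP: cL; apply => e e0; have [n] := half_small 1 e0; rewrite mul1r => hn.
    by exists (u n) => //; exact: le_lt_trans (sP' n) hn.
  apply: le_trans (_ : rnorm (s - u 0%N) + rnorm (u 0%N) <= _).
    by rewrite -[X in rnorm X <= _](subrK (u 0%N)) rnormD.
  by rewrite {2}/u big_ord0 rnorm0 addr0 (le_trans (sP' 0%N)).
Qed.

Lemma spans_unit L : subspace L -> spans (unit_disc L) L.
Proof.
move=> hL; split=> [x []//|a La].
have [a0|a0] := eqVneq (rnorm a) 0.
  exists 0 => //; exists 0; first by split; [exact: subspace0|rewrite rnorm0].
  by rewrite scaler0; exact: rnorm_eq0.
exists (rnorm a); first exact: rnorm_ge0.
exists (rc (rnorm a)^-1 *: a).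
  split; first exact: subspaceZ.
  by rewrite rnormZr ger0_norm ?invr_ge0 ?rnorm_ge0 // mulVf.
by rewrite scalerA -rmorphM divff // scale1r.
Qed.

Lemma disc_image f (M : R) B : 0 <= M -> (forall x, rnorm (f x) <= M * rnorm x) ->
  disc B -> disc (f @` B).
Proof.
move=> M0 fM [B0 Bc [c Bs]]; split; first by exists 0; rewrite ?linear0.
  move=> s t st _ _ [x Bx <-] [y By <-]; exists (rc s *: x + rc t *: y); first exact: Bc.
  by rewrite linearD !linearZ.
exists (M * c) => b fb.
have /choice[g gP] : forall k, exists a, B a /\ f a = b k.
  by move=> k; have [a Ba fa] := fb k; exists a.
have [|s sB sP] := Bs g; first by move=> k; case: (gP k).
exists (f s); first by exists s.
move=> n; have -> : \sum_(k < n) rc (h ^+ k.+1) *: b k = f (\sum_(k < n) rc (h ^+ k.+1) *: g k).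
  by rewrite linear_sum; apply: eq_bigr => k _; rewrite linearZ /= (gP k).2.
by rewrite -linearB -mulrA; apply: le_trans (fM _) (ler_wpM2l _ (sP n)).
Qed.

Lemma spans_image f B A : spans B A -> spans (f @` B) (f @` A).
Proof.
move=> [BA AB]; split; first exact: image_subset.
move=> _ [a Aa <-]; have [t t0 [b Bb ->]] := AB a Aa.
by exists t => //; exists (f b); [exists b|rewrite linearZ].
Qed.

Lemma disc_sum B B' : disc B -> disc B' -> disc (sum_set B B').
Proof.
move=> [B0 Bc [c Bs]] [B0' Bc' [c' Bs']]; split.
- by exists 0 => //; exists 0; rewrite ?addr0.
- move=> s t st _ _ [x Bx [x' Bx' <-]] [y By [y' By' <-]].
  exists (rc s *: x + rc t *: y); first exact: Bc.
  by exists (rc s *: x' + rc t *: y'); [exact: Bc'|rewrite !scalerDr addrACA].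
- exists (c + c') => b bB.
  have /choice[g gP] : forall k, exists p : X * X, [/\ B p.1, B' p.2 & p.1 + p.2 = b k].
    by move=> k; have [x Bx [y By e]] := bB k; exists (x, y).
  have [|s sB sP] := Bs (fun k => (g k).1); first by move=> k; case: (gP k).
  have [|s' sB' sP'] := Bs' (fun k => (g k).2); first by move=> k; case: (gP k).
  exists (s + s'); first by exists s => //; exists s'.
  move=> n; have -> : \sum_(k < n) rc (h ^+ k.+1) *: b k =
      \sum_(k < n) rc (h ^+ k.+1) *: (g k).1 + \sum_(k < n) rc (h ^+ k.+1) *: (g k).2.
    by rewrite -big_split; apply: eq_bigr => k _; rewrite /= -scalerDr; case: (gP k) => _ _ ->.
  by rewrite opprD addrACA mulrDl; apply: le_trans (rnormD _ _) (lerD (sP n) (sP' n)).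
Qed.

Lemma disc_shrink B (s t : R) x : disc B -> 0 <= s -> s <= t -> B x ->
  exists2 y, B y & rc s *: x = rc t *: y.
Proof.
move=> [B0 Bc _] s0 st Bx.
have [t0|t0] := eqVneq t 0.
  exists x => //; congr (rc _ *: _); apply/eqP; by rewrite eq_le st t0 s0.
have tp : 0 < t by rewrite lt_def t0 (le_trans s0).
exists (rc (s / t) *: x + rc 0 *: 0).
  by apply: Bc => //; rewrite normr0 addr0 ger0_norm ?ler_pdivrMr ?mul1r // divr_ge0 // ltW.
by rewrite scaler0 addr0 scalerA -rmorphM mulrC divfK.
Qed.

Lemma spans_sum B B' A A' : disc B -> disc B' -> spans B A -> spans B' A' ->
  spans (sum_set B B') (sum_set A A').
Proof.
move=> dB dB' [BA AB] [BA' AB']; split.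
  by move=> _ [x Bx [y By <-]]; exists x; [exact: BA|exists y; [exact: BA'|]].
move=> _ [a /AB[t t0 [b Bb ->]] [a' /AB'[t' t0' [b' Bb' ->]] <-]].
have [|y By ->] := disc_shrink dB t0 _ Bb (t := t + t'); first by rewrite lerDl.
have [|y' By' ->] := disc_shrink dB' t0' _ Bb' (t := t + t'); first by rewrite lerDr.
by exists (t + t'); [exact: addr_ge0|exists (y + y'); [exists y => //; exists y'|rewrite scalerDr]].
Qed.

(** Baire's theorem yields a multiple of [B] whose closure contains a ball of
    [Y]. Approximating a vector by elements of [B], then the error by elements of
    [B / 2], and so on, writes it as the sum of a series that converges in [B]. *)
Lemma open_mapping B Y : disc B -> subspace Y -> closed Y -> spans B Y ->
  exists2 C : R, 0 < C &
    forall y, Y y -> exists2 b, B b & y = rc (C * rnorm y) *: b.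
Proof.
move=> dB hY cY [BY YB].
have [B0 Bc [c Bs]] := dB.
pose F n : set X := [set rc n.+1%:R *: b | b in B].
have [||n [y0 [r [Yy0 r0 hr]]]] := @baire_closed _ _ Y F cY.
- by exists 0; exact: subspace0.
- move=> y /YB[t t0 [b Bb ->]]; exists (Num.truncn t).
  have [|y' By' ->] := disc_shrink dB t0 _ Bb (t := (Num.truncn t).+1%:R).
    by rewrite ltW // truncnS_gt.
  by exists y'.
pose N : R := 2 * n.+1%:R.
have dense0 x (e : R) : Y x -> rnorm x < r -> 0 < e ->
    exists2 b, B b & rnorm (x - rc N *: b) < e.
  move=> Yx xr e0.
  have e2 : 0 < e / 2 by rewrite divr_gt0.
  have /closureP/(_ _ e2)[_ [b1 Bb1 <-] h1] : closure (F n) (x + y0).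
    by apply: hr; [exact: subspaceD|rewrite addrK].
  have /closureP/(_ _ e2)[_ [b2 Bb2 <-] h2] : closure (F n) y0.
    by apply: hr => //; rewrite subrr rnorm0.
  (* Half the difference is in [B], so [N] is twice the integer from Baire. *)
  exists (rc h *: b1 + rc (- h) *: b2).
    by apply: Bc => //; rewrite normrN ger0_norm //; lra.
  have -> : x - rc N *: (rc h *: b1 + rc (- h) *: b2) =
      (x + y0 - rc n.+1%:R *: b1) - (y0 - rc n.+1%:R *: b2).
    rewrite scalerDr !scalerA -!rmorphM mulrN.
    have -> : N * h = n.+1%:R by rewrite /N mulrAC divff ?mul1r.
    by rewrite rmorphN scaleNr !opprD !opprK !addrA [_ - y0]addrAC addrK.
  apply: le_lt_trans (rnormD _ _) _; rewrite rnormN.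
  by rewrite [ltRHS](splitr e); apply: ltrD.
(* Scaling a vector of norm at most [t] by [r / (2 t)] puts it strictly inside
   the ball of radius [r]. *)
pose C := N * (2 / r).
have N0 : 0 < N by rewrite mulr_gt0 ?ltr0n.
have C0 : 0 < C by rewrite mulr_gt0 // divr_gt0.
have dense x (t e : R) : Y x -> rnorm x <= t -> 0 < t -> 0 < e ->
    exists2 b, B b & rnorm (x - rc (C * t) *: b) < e.
  move=> Yx xt t0 e0; pose q := 2 / r * t.
  have q0 : 0 < q by rewrite mulr_gt0 // divr_gt0.
  have [||b Bb hb] := dense0 (rc q^-1 *: x) (q^-1 * e) (subspaceZ hY _ Yx).
  - rewrite rnormZr ger0_norm ?invr_ge0 ?ltW //.
    rewrite mulrC ltr_pdivrMr // /q mulrA mulrA [r * 2]mulrC mulfK ?gt_eqF //.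
    by apply: le_lt_trans xt _; lra.
  - by rewrite mulr_gt0 ?invr_gt0.
  exists b => //.
  move: hb; rewrite -(ltr_pM2l q0) mulrA divff ?gt_eqF // mul1r.
  congr (_ < _); rewrite -{1}(ger0_norm (ltW q0)) -rnormZr scalerBr !scalerA -!rmorphM.
  by rewrite divff ?gt_eqF // scale1r /C /q mulrC mulrA.
exists (2 * C) => [|y Yy]; first by rewrite mulr_gt0.
have [y00|y00] := eqVneq (rnorm y) 0.
  by exists 0 => //; rewrite scaler0; exact: rnorm_eq0.
pose t := rnorm y; have t0 : 0 < t by rewrite lt_def y00 rnorm_ge0.
have tn n0 : 0 < t * h ^+ n0 by rewrite mulr_gt0 // exprn_gt0.
have /choice[g gP] : forall p : nat * X, exists b, Y p.2 -> rnorm p.2 <= t * h ^+ p.1 ->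
    B b /\ rnorm (p.2 - rc (C * (t * h ^+ p.1)) *: b) <= t * h ^+ p.1.+1.
  move=> [k x] /=; have [[Yx xt]|nx] := pselect (Y x /\ rnorm x <= t * h ^+ k).
    by have [b Bb hb] := dense x _ _ Yx xt (tn _) (tn k.+1); exists b => _ _; split=> //; exact: ltW.
  by exists 0 => ? ?; case: nx.
pose fix z (k : nat) : X := if k is j.+1 then z j - rc (C * (t * h ^+ j)) *: g (j, z j) else y.
have zP k : Y (z k) /\ rnorm (z k) <= t * h ^+ k.
  elim: k => [|k [IH1 IH2]] /=; first by rewrite expr0 mulr1.
  have [Bg ?] := gP (k, z k) IH1 IH2; split=> //.
  by apply: subspaceB => //; apply: subspaceZ => //; exact: BY.
have bP k : B (g (k, z k)) by have [? ?] := zP k; case: (gP (k, z k)).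
have [s sB sP] := Bs _ bP; exists s => //.
have zE k : z k = y - rc (2 * C * t) *: \sum_(j < k) rc (h ^+ j.+1) *: g (j : nat, z j).
  elim: k => [|k IH]; first by rewrite big_ord0 scaler0 subr0.
  rewrite big_ord_recr /= {1}IH scalerDr scalerA -rmorphM opprD addrA.
  congr (_ - rc _ *: _); rewrite exprS; lra.
apply/eqP; rewrite -subr_eq0; apply/eqP/rnorm_small => e e0.
have [k hk] := half_small (t + 2 * C * t * c) e0.
apply: le_trans (ltW hk).
have -> : y - rc (2 * C * t) *: s = z k -
    rc (2 * C * t) *: (s - \sum_(j < k) rc (h ^+ j.+1) *: g (j : nat, z j)).
  by rewrite zE scalerBr opprB addrA subrK.
apply: le_trans (rnormD _ _) _; rewrite rnormN rnormZr [leRHS]mulrDl; apply: lerD.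
  by case: (zP k).
have Ct : 0 <= 2 * C * t by apply/ltW; rewrite mulr_gt0 // mulr_gt0.
by rewrite ger0_norm // -[leRHS]mulrA; apply: ler_wpM2l.
Qed.

(** The open mapping theorem, applied to the sum of [B] and the unit disc of [L],
    bounds the projection onto [L] along [A], and [A] is its kernel. *)
Lemma closed_summand B A L : disc B -> spans B A -> subspace A ->
  subspace L -> closed L -> A `&` L = [set 0] -> closed (sum_set A L) -> closed A.
Proof.
move=> dB sBA hA hL cL AL cAL.
have dS := disc_sum dB (disc_unit hL cL).
have sS := spans_sum dB (disc_unit hL cL) sBA (spans_unit hL).
have [C C0 hC] := open_mapping dS (subspace_add hA hL) cAL sS.
apply/closedP => x xA.
have [a Aa [l Ll xE]] : sum_set A L x.
  move/closedP: cAL; apply => e e0; have [a Aa xa] := xA e e0; exists a => //.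
  by exists a => //; exists 0; [exact: subspace0|rewrite addr0].
suff l0 : l = 0 by rewrite -xE l0 addr0.
apply: rnorm_small => e e0.
have [a' Aa' xa] := xA _ (divr_gt0 e0 C0).
have Saux : sum_set A L (x - a').
  by exists (a - a'); [exact: subspaceB|exists l => //; rewrite -xE addrAC].
have [_ [b Bb [u [Lu u1] <-]] xbu] := hC _ Saux.
have lE : l = rc (C * rnorm (x - a')) *: u.
  apply/eqP; rewrite -subr_eq0; apply/eqP.
  have : (A `&` L) (l - rc (C * rnorm (x - a')) *: u); last by rewrite AL.
  split; last by apply: subspaceB => //; exact: subspaceZ.
  have -> : l - rc (C * rnorm (x - a')) *: u = rc (C * rnorm (x - a')) *: b - (a - a').
    apply/eqP; rewrite subr_eq addrAC eq_sym subr_eq -scalerDr -xbu -xE.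
    by rewrite [l + _]addrC addrAC.
  apply: subspaceB; [by []|apply: subspaceZ => //; exact: sBA.1|exact: subspaceB].
rewrite lE rnormZr ger0_norm ?mulr_ge0 ?rnorm_ge0 ?(ltW C0) //.
apply: (@le_trans _ _ (C * rnorm (x - a'))).
  by rewrite -[leRHS]mulr1 ler_wpM2l // mulr_ge0 ?rnorm_ge0 // ltW.
by move: xa; rewrite ltr_pdivlMr // mulrC => /ltW.
Qed.

End Discs.
(** * Hahn-Banach, and finite-dimensional subspaces *)

Section Sublinear.
Context {R : realType} {X : normedModType R[i]}.
Implicit Types (p q : X -> R) (x y : X).

Definition sublinear q := [/\ q 0 = 0, forall x y, q (x + y) <= q x + q y &
  forall (t : R) x, 0 < t -> q (rc t *: x) = t * q x].

Lemma sublinearN q x : sublinear q -> - q (- x) <= q x.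
Proof. by move=> [q0 qD _]; rewrite lerNl -subr_ge0 opprK addrC -q0 -[X in q X](subrr x) qD. Qed.

(** One criterion serves twice: for the infimum of a chain of sublinear
    functions and for the infimal convolution with a cone. *)
Lemma sublinear_inf (Q : set (X -> R)) :
  (exists2 q, Q q & q 0 <= 0) -> (forall q, Q q -> 0 <= q 0) ->
  (forall x, exists b, forall q, Q q -> b <= q x) ->
  (forall q q', Q q -> Q q' ->
     exists2 r, Q r & forall x y, r (x + y) <= q x + q' y) ->
  (forall q (t : R), Q q -> 0 < t ->
     exists2 r, Q r & forall x, r (rc t *: x) <= t * q x) ->
  let m x := inf [set q x | q in Q] in
  sublinear m /\ forall q x, Q q -> m x <= q x.
Proof.
move=> [q0 Qq0 q00] Q0 Qb QD QZ m.
have mle q x : Q q -> m x <= q x.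
  move=> Qq; have [b bP] := Qb x; apply: ge_inf; last by exists q.
  by exists b => _ [q' Qq' <-]; exact: bP.
have m_ge b x : (forall q, Q q -> b <= q x) -> b <= m x.
  move=> bP; apply: lb_le_inf; first by exists (q0 x), q0.
  by move=> _ [q Qq <-]; exact: bP.
have mZ (t : R) x : 0 < t -> m (rc t *: x) <= t * m x.
  move=> t0; rewrite -ler_pdivrMl //; apply/m_ge => q Qq.
  have [r Qr rq] := QZ q t Qq t0; rewrite ler_pdivrMl //.
  by apply: le_trans (rq x); exact: mle.
split=> //; split.
- by apply/eqP; rewrite eq_le; apply/andP; split; [exact: le_trans (mle _ _ Qq0) q00|exact/m_ge].
- move=> x y; rewrite -lerBlDr; apply/m_ge => q Qq; rewrite lerBlDr -lerBlDl.
  apply/m_ge => q' Qq'; rewrite lerBlDl.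
  by have [r Qr rP] := QD _ _ Qq Qq'; apply: le_trans (rP x y); exact: mle.
- move=> t x t0; apply/eqP; rewrite eq_le mZ //=.
  have ti : 0 < t^-1 by rewrite invr_gt0.
  have := mZ t^-1 (rc t *: x) ti.
  by rewrite scalerA -rmorphM mulVf ?gt_eqF // scale1r ler_pdivlMl.
Qed.

(** Infimal convolution of [p] with the function [c] on the cone [C]; linear
    minorants of the result are at least [c] on [C]. *)
Lemma sublinear_cone p (C : set X) (c : X -> R) : sublinear p ->
  C 0 -> (forall u v, C u -> C v -> C (u + v) /\ c (u + v) = c u + c v) ->
  (forall (t : R) u, 0 < t -> C u -> C (rc t *: u) /\ c (rc t *: u) = t * c u) ->
  (forall u, C u -> c u <= p u) ->
  exists q, [/\ sublinear q, forall x, q x <= p x & forall u, C u -> q (- u) <= - c u].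
Proof.
move=> [p0 pD pZ] C0 CD CZ cp.
have c0 : c 0 = 0.
  have [_] := CD _ _ C0 C0; rewrite addr0 => /eqP.
  by rewrite -subr_eq0 opprD addrA subrr sub0r oppr_eq0 => /eqP.
pose Q : set (X -> R) := [set fun x => p (x + u) - c u | u in C].
have [||||| sm mle] := @sublinear_inf Q.
- by exists (fun x => p (x + 0) - c 0); [exists 0|rewrite addr0 p0 c0 subrr].
- by move=> _ [u Cu <-]; rewrite add0r subr_ge0 cp.
- move=> x; exists (- p (- x)) => _ [u Cu <-].
  rewrite lerBrDr addrC lerBlDr; apply: le_trans (cp u Cu) _.
  by apply: le_trans (pD _ _); rewrite addrAC subrr add0r.
- move=> _ _ [u Cu <-] [v Cv <-]; have [Cuv cuv] := CD _ _ Cu Cv.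
  exists (fun x => p (x + (u + v)) - c (u + v)); first by exists (u + v).
  move=> x y; rewrite cuv addrACA [leRHS]addrACA -opprD lerD2r; exact: pD.
- move=> _ t [u Cu <-] t0; have [Ctu ctu] := CZ _ _ t0 Cu.
  exists (fun x => p (x + rc t *: u) - c (rc t *: u)); first by exists (rc t *: u).
  by move=> x; rewrite -scalerDr ctu pZ // mulrBr.
exists (fun x => inf [set q x | q in Q]); split=> //.
- move=> x; have Q0 : Q (fun x => p (x + 0) - c 0) by exists 0.
  by apply: le_trans (mle _ x Q0) _; rewrite addr0 c0 subr0.
- move=> u Cu; have Qu : Q (fun x => p (x + u) - c u) by exists u.
  by apply: le_trans (mle _ (- u) Qu) _; rewrite addNr p0 sub0r.
Qed.

(** Sublinear functions that are minimal for the pointwise order are additive: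
    otherwise convolution with a ray would lower them. *)
Lemma minimal_sublinear p : sublinear p -> exists g : X -> R,
  [/\ forall x, g x <= p x, forall x y, g (x + y) = g x + g y &
      forall (t : R) x, g (rc t *: x) = t * g x].
Proof.
move=> sp.
pose P q := sublinear q /\ forall x, q x <= p x.
pose S := {q : X -> R | P q}.
pose Rel (a b : S) := `[< forall x, sval b x <= sval a x >].
have Rr a : Rel a a by apply/asboolP.
have Rt a b c : Rel a b -> Rel b c -> Rel a c.
  by move=> /asboolP ab /asboolP bc; apply/asboolP => x; exact: le_trans (bc x) (ab x).
have p_in : P p by [].
have [|[g [sg gp]] ming] := @ZL_preorder S (exist P p p_in) Rel Rr Rt.
  move=> A Atot; have [[a0 Aa0]|A0] := pselect (exists a, A a); last first.
    by exists (exist P p p_in) => s As; case: A0; exists s.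
  pose Q : set (X -> R) := [set sval a | a in A].
  have [||||| sm mle] := @sublinear_inf Q.
  - by exists (sval a0); [exists a0|case: (svalP a0) => -[->]].
  - by move=> _ [a _ <-]; case: (svalP a) => -[->].
  - move=> x; exists (- p (- x)) => _ [a _ <-]; have [sa ap] := svalP a.
    by apply: le_trans (sublinearN _ sa); rewrite lerN2.
  - move=> _ _ [a Aa <-] [b Ab <-].
    have [/asboolP ab|/asboolP ba] := Atot _ _ Aa Ab.
      exists (sval b); first by exists b.
      by move=> x y; have [[_ bD _] _] := svalP b; apply: le_trans (bD _ _) _; rewrite lerD2r.
    exists (sval a); first by exists a.
    by move=> x y; have [[_ aD _] _] := svalP a; apply: le_trans (aD _ _) _; rewrite lerD2l.
  - move=> _ t [a Aa <-] t0; exists (sval a); first by exists a.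
    by move=> x; have [[_ _ aZ] _] := svalP a; rewrite aZ.
  have m_in : P (fun x => inf [set q x | q in Q]).
    split=> // x; have [_ ap] := svalP a0; apply: le_trans (ap x).
    by apply: mle; exists a0.
  exists (exist P _ m_in) => a Aa; apply/asboolP => x /=.
  by apply: mle; exists a.
have [g0 gD gZ] := sg.
have gN y : g (- y) = - g y.
  apply/eqP; rewrite eq_le lerNl sublinearN // andbT.
  have [||||q [sq qg qN]] := @sublinear_cone g [set y' | exists2 t : R, 0 <= t & y' = rc t *: y] g sg.
  - by exists 0; rewrite // scale0r.
  - move=> _ _ [s s0 ->] [t t0 ->]; rewrite -scalerDl -rmorphD.
    split; first by exists (s + t); rewrite ?addr_ge0.
    have gZ0 r : 0 <= r -> g (rc r *: y) = r * g y.
      by rewrite le_eqVlt => /orP[/eqP <-|/gZ->//]; rewrite scale0r mul0r.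
    by rewrite !gZ0 ?addr_ge0 // mulrDl.
  - move=> t _ t0 [s s0 ->]; split; last exact: gZ.
    by exists (t * s); [rewrite mulr_ge0 // ltW|rewrite scalerA -rmorphM].
  - by [].
  have q_in : P q.
    by split=> // x; apply: le_trans (qg x) (gp x).
  have /asboolP/(_ (- y)) /= gq : Rel (exist P q q_in) (exist P g (conj sg gp)).
    by apply: ming; apply/asboolP.
  apply: le_trans gq _; apply: qN; exists 1 => //; by rewrite scale1r.
exists g; split=> // [x y|t x].
  apply/eqP; rewrite eq_le gD /= -lerBrDr -gN.
  by apply: le_trans (gD _ _); rewrite addrK.
have [t0|t0|->] := ltgtP t 0; last 2 first.
- exact: gZ.
- by rewrite scale0r mul0r.
rewrite -[t]opprK rmorphN scaleNr gN gZ ?oppr_gt0 //.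
by rewrite -mulNr.
Qed.

Lemma rnorm_complex (a b : R) : rnorm (Complex a b : R[i]) <= `|a| + `|b|.
Proof.
have -> : Complex a b = rc a + rc b * 'i%C :> R[i].
  by apply/eqP; rewrite eq_complex /= !mul0r !mulr0 !mulr1 subr0 !addr0 !add0r !eqxx.
apply: le_trans (rnormD _ _) _; rewrite rnormM !rnorm_rc.
suff -> : rnorm ('i%C : R[i]) = 1 by rewrite mulr1.
by rewrite /rnorm normc_def /= expr0n expr1n add0r sqrtr1.
Qed.

(** The distance to [L] is sublinear and vanishes on [L]; convolving it with
    the ray of [z] forces a minimal minorant to be positive at [z], and its
    complexification separates. *)
Lemma hahn_banach (L : set X) z : subspace L -> closed L -> ~ L z ->
  exists f : X -> R[i], [/\ forall a u v, f (a *: u + v) = a * f u + f v,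
    forall x, L x -> f x = 0, f z = 1 &
    exists2 M : R, 0 <= M & forall x, rnorm (f x) <= M * rnorm x].
Proof.
move=> hL /closedP cL nLz.
pose Q : set (X -> R) := [set fun x => rnorm (x - u) | u in L].
have [||||| s0 d_le] := @sublinear_inf Q.
- exists (fun x => rnorm (x - 0)); last by rewrite subr0 rnorm0.
  by exists 0 => //; exact: subspace0.
- by move=> _ [u _ <-]; exact: rnorm_ge0.
- by move=> x; exists 0 => _ [u _ <-]; exact: rnorm_ge0.
- move=> _ _ [u Lu <-] [v Lv <-]; exists (fun x => rnorm (x - (u + v))).
    by exists (u + v) => //; exact: subspaceD.
  by move=> x y; rewrite opprD addrACA; exact: rnormD.
- move=> _ t [u Lu <-] t0; exists (fun x => rnorm (x - rc t *: u)).
    by exists (rc t *: u) => //; exact: subspaceZ.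
  by move=> x; rewrite -scalerBr rnormZr gtr0_norm.
pose d x := inf [set q x | q in Q].
have d_norm x : d x <= rnorm x.
  have Q0 : Q (fun x => rnorm (x - 0)) by exists 0 => //; exact: subspace0.
  by apply: le_trans (d_le _ x Q0) _; rewrite subr0.
have dL x : L x -> d x <= 0.
  move=> Lx; have Qx : Q (fun y => rnorm (y - x)) by exists x.
  by apply: le_trans (d_le _ x Qx) _; rewrite subrr rnorm0.
have dz : 0 < d z.
  rewrite ltNge; apply/negP => dz0; apply: nLz; apply: cL => e e0.
  have [_ [q [u Lu <-] <-] xu] : exists2 y, [set q z | q in Q] y & y < e.
    apply: inf_lt; last exact: le_lt_trans dz0 e0.
    exists (rnorm (z - 0)); exists (fun x => rnorm (x - 0)) => //.
    by exists 0 => //; exact: subspace0.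
  by exists u.
have sd : sublinear d := s0.
have [d0 dD dZ] := sd.
have dray (t : R) : 0 <= t -> d (rc t *: z) = t * d z.
  by rewrite le_eqVlt => /orP[/eqP <-|/dZ->//]; rewrite scale0r mul0r.
have [||||q [sq qd qN]] := @sublinear_cone d [set y | exists2 t : R, 0 <= t & y = rc t *: z] d sd.
- by exists 0; rewrite // scale0r.
- move=> _ _ [s s1 ->] [t t1 ->]; rewrite -scalerDl -rmorphD.
  split; first by exists (s + t); rewrite ?addr_ge0.
  by rewrite !dray ?addr_ge0 // mulrDl.
- move=> t _ t0 [s s1 ->]; split; last exact: dZ.
  by exists (t * s); [rewrite mulr_ge0 // ltW|rewrite scalerA -rmorphM].
- by [].
have [g [gq gD gZ]] := minimal_sublinear sq.
have gd x : g x <= d x := le_trans (gq x) (qd x).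
have gN x : g (- x) = - g x by have := gZ (-1) x; rewrite rmorphN1 scaleN1r mulN1r.
have gL x : L x -> g x = 0.
  move=> Lx; apply/eqP; rewrite eq_le (le_trans (gd x)) ?dL //= -oppr_le0 -gN.
  by apply: le_trans (gd _) _; apply: dL; exact: subspaceN.
have gz : 0 < g z.
  apply: lt_le_trans dz _; rewrite -lerN2 -gN; apply: le_trans (gq _) _; apply: qN.
  by exists 1 => //; rewrite scale1r.
have gB x : `|g x| <= rnorm x.
  rewrite ler_norml; apply/andP; split; last exact: le_trans (gd x) (d_norm x).
  rewrite lerNl -gN -rnormN; exact: le_trans (gd _) (d_norm _).
pose F x : R[i] := Complex (g x) (- g ('i%C *: x)).
have FZ a x : F (a *: x) = a * F x.
  have gC (b : R[i]) y : g (b *: y) = complex.Re b * g y + complex.Im b * g ('i%C *: y).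
    by rewrite {1}(complexE b) ['i%C * _]mulrC scalerDl -scalerA gD !gZ.
  rewrite /F scalerA (gC a) (gC (_ * a)); case: a => a b; apply/eqP; rewrite eq_complex /=.
  by apply/andP; split; apply/eqP; lra.
have FD x y : F (x + y) = F x + F y.
  by apply/eqP; rewrite eq_complex /= scalerDr !gD opprD !eqxx.
have Fz : F z != 0 by apply/eqP => -[h _]; rewrite h ltxx in gz.
exists (fun x => F x / F z); split.
- by move=> a u v; rewrite FD FZ mulrDl mulrA.
- move=> x Lx; have Lix : L ('i%C *: x) by exact: subspaceZ.
  by have -> : F x = 0; [rewrite /F (gL _ Lx) (gL _ Lix) oppr0|rewrite mul0r].
- by rewrite divff.
- exists (2 * rnorm (F z)^-1); first by rewrite mulr_ge0 // rnorm_ge0.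
  move=> x; rewrite rnormM mulrAC ler_wpM2r ?rnorm_ge0 //.
  apply: le_trans (rnorm_complex _ _) _; rewrite normrN.
  have := gB ('i%C *: x); rewrite rnormZ.
  have -> : rnorm ('i%C : R[i]) = 1 by rewrite /rnorm normc_def /= expr0n expr1n add0r sqrtr1.
  by rewrite mul1r => h; have := gB x; lra.
Qed.

End Sublinear.

Section FiniteDimension.
Context {R : realType} {X : normedModType R[i]}.
Implicit Types (L F V A : set X) (x y : X).

Definition span n (e : 'I_n -> X) : set X :=
  [set \sum_i c i *: e i | c in [set: {ffun 'I_n -> R[i]}]].

Lemma closed_zero : closed [set 0 : X].
Proof.
apply/closedP => x hx; apply: rnorm_small => e /hx[_ ->].
by rewrite subr0 => /ltW.
Qed.

(** With a bounded functional [f] that vanishes on [L] and takes the value 1 at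
    [z], a limit [x] of points of [L + <z>] is such that [x - f x z] is a limit of
    points of [L]. *)
Lemma closed_add_line L z : subspace L -> closed L ->
  closed (sum_set L [set a *: z | a in [set: R[i]]]).
Proof.
move=> hL cL; have [Lz|nLz] := pselect (L z).
  suff -> : sum_set L [set a *: z | a in [set: R[i]]] = L by [].
  apply/seteqP; split=> [_ [l Ll [_ [a _ <-] <-]]|l Ll].
    by apply: subspaceD => //; exact: subspaceZ.
  by exists l => //; exists 0; [exists 0; rewrite ?scale0r|rewrite addr0].
have [f [fP fL fz [M M0 fM]]] := hahn_banach hL cL nLz.
have fB u v : f (u - v) = f u - f v.
  by rewrite addrC -scaleN1r fP mulN1r addrC.
apply/closedP => x hx.
exists (x - f x *: z); last by exists (f x *: z); [exists (f x)|rewrite subrK].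
move/closedP: cL; apply => e e0.
have M1 : 0 < 1 + M * rnorm z by rewrite ltr_pwDl // mulr_ge0 // rnorm_ge0.
have [_ [l Ll [_ [a _ <-] <-]] xl] := hx _ (divr_gt0 e0 M1).
exists l => //.
have fxa : f (x - (l + a *: z)) = f x - a.
  by rewrite fB addrC [l + _]addrC fP (fL l) // fz mulr1 addr0 addrC.
have -> : x - f x *: z - l = (x - (l + a *: z)) - f (x - (l + a *: z)) *: z.
  by rewrite fxa scalerBl opprB opprD !addrA subrK addrAC.
apply: le_lt_trans (rnormD _ _) _; rewrite rnormN rnormZ.
rewrite ltr_pdivlMr // mulrDr mulr1 in xl; apply: le_lt_trans xl.
by rewrite lerD2l mulrA ler_wpM2r ?rnorm_ge0 // mulrC.
Qed.

Lemma closed_add_span L n (e : 'I_n -> X) : subspace L -> closed L ->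
  closed (sum_set L (span e)).
Proof.
elim: n e => [|n IH] e hL cL.
  suff -> : sum_set L (span e) = L by [].
  apply/seteqP; split=> [_ [l Ll [_ [c _ <-] <-]]|l Ll]; first by rewrite big_ord0 addr0.
  by exists l => //; exists 0; [exists 0; rewrite ?big_ord0|rewrite addr0].
pose e' i := e (widen_ord (leqnSn n) i).
have hS : subspace (sum_set L (span e')) by apply: subspace_add => //; exact: subspace_span.
have -> : sum_set L (span e) =
    sum_set (sum_set L (span e')) [set a *: e ord_max | a in [set: R[i]]].
  apply/seteqP; split=> [_ [l Ll [_ [c _ <-] <-]]|_ [_ [l Ll [_ [c _ <-] <-]] [_ [a _ <-] <-]]].
    rewrite big_ord_recr addrA; exists (l + \sum_(i < n) c (widen_ord (leqnSn n) i) *: e' i).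
      exists l => //; eexists; last by [].
      by exists [ffun i => c (widen_ord (leqnSn n) i)] => //; apply: eq_bigr => i _; rewrite ffunE.
    by exists (c ord_max *: e ord_max) => //; exists (c ord_max).
  rewrite -addrA; exists l => //; eexists; last by [].
  exists [ffun i => if unlift ord_max i is Some j then c j else a] => //.
  rewrite big_ord_recr /= ffunE unlift_none; congr (_ + _); apply: eq_bigr => i _.
  rewrite ffunE /e'; have -> : widen_ord (leqnSn n) i = lift ord_max i.
    by apply: val_inj; rewrite /= /bump leqNgt ltn_ord.
  by rewrite liftK.
exact: closed_add_line hS (IH e' hL cL).
Qed.

Lemma closed_span n (e : 'I_n -> X) : closed (span e).
Proof.
suff -> : span e = sum_set [set 0] (span e).
  apply: closed_add_span; [exact: subspace_zero|exact: closed_zero].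
apply/seteqP; split=> [x ex|_ [_ -> [x ex <-]]]; last by rewrite add0r.
by exists 0 => //; exists x; rewrite ?add0r.
Qed.

Lemma fin_dim_span F : subspace F -> (qdim F [set 0%R] < +oo)%E ->
  exists n (e : 'I_n -> X), F = span e /\ free_mod [set 0] e.
Proof.
move=> hF /qdim_fin[n /(has_qdimP _ hF subspace_zero)[e [Fe fe se]]].
exists n, e; split=> //; apply/seteqP; split=> [x /se[c /eqP]|_ [c _ <-]].
  by rewrite subr_eq0 => /eqP ->; exists c.
by apply: subspace_sum => // i; exact: subspaceZ.
Qed.

Lemma closed_add_fin_dim L F : subspace L -> closed L -> subspace F ->
  (qdim F [set 0%R] < +oo)%E -> closed (sum_set L F).
Proof. by move=> hL cL hF /(fin_dim_span hF)[n [e [-> _]]]; exact: closed_add_span. Qed.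

(** A finite-dimensional subspace is complemented by the common kernel of
    bounded functionals dual to one of its bases. *)
Lemma fin_dim_complement F : subspace F -> (qdim F [set 0%R] < +oo)%E ->
  exists Z, [/\ subspace Z, closed Z, F `&` Z = [set 0] & sum_set F Z = setT].
Proof.
move=> hF /(fin_dim_span hF)[n [e [FE fe]]].
have /choice[f fP] : forall i : 'I_n, exists f : X -> R[i],
    [/\ forall a u v, f (a *: u + v) = a * f u + f v,
        forall j, f (e j) = (j == i)%:R &
        exists2 M : R, 0 <= M & forall x, rnorm (f x) <= M * rnorm x].
  (* [e i] lies off the closed span [e'] of the other vectors of the basis. *)
  move=> i; pose e' (j : 'I_n) : X := if j == i then 0 else e j.
  have ne : ~ span e' (e i).
    move=> [c _ cE].
    have /ffunP/(_ i) : [ffun j => if j == i then -1 else c j] = 0 :> {ffun 'I_n -> R[i]}.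
      apply: fe => /=; rewrite (bigD1 i) //= ffunE eqxx scaleN1r -cE (bigD1 i) //=.
      rewrite /e' eqxx scaler0 add0r addrC -sumrB big1 // => j /negPf ji.
      by rewrite ffunE ji subrr.
    by rewrite !ffunE eqxx => /eqP; rewrite oppr_eq0 oner_eq0.
  have [f [fP fL fz fM]] := hahn_banach (subspace_span e') (@closed_span _ e') ne.
  exists f; split=> // j; have [->//|ji] := eqVneq j i; apply: fL.
  exists [ffun k => (k == j)%:R] => //.
  rewrite (bigD1 j) //= ffunE eqxx scale1r big1 ?addr0 => [|k /negPf kj].
    by rewrite /e' (negPf ji).
  by rewrite ffunE kj scale0r.
have f0 i : f i 0 = 0.
  have [h _ _] := fP i; have /eqP := h 1 0 0.
  by rewrite scale1r addr0 mul1r -subr_eq0 opprD addrA subrr sub0r oppr_eq0 => /eqP.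
have fsum i (c : {ffun 'I_n -> R[i]}) : f i (\sum_j c j *: e j) = c i.
  have [h fe' _] := fP i.
  have fS (I : seq 'I_n) : f i (\sum_(j <- I) c j *: e j) = \sum_(j <- I) c j * (j == i)%:R.
    by elim: I => [|j I IH]; rewrite ?big_nil ?f0 // !big_cons h IH fe'.
  rewrite fS (bigD1 i) //= eqxx mulr1 big1 ?addr0 // => j /negPf ->.
  by rewrite mulr0.
exists [set x | forall i, f i x = 0]; split.
- split=> [i|a u v hu hv i]; first exact: f0.
  by have [h _ _] := fP i; rewrite h hu hv mulr0 addr0.
- apply/closedP => x hx i; have [h _ [M M0 fM]] := fP i.
  apply: rnorm_small => e1 e10.
  have M1 : 0 < M + 1 by rewrite ltr_wpDl.
  have [y hy xy] := hx _ (divr_gt0 e10 M1).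
  have -> : f i x = f i (x - y).
    by rewrite addrC -scaleN1r h hy mulr0 add0r.
  apply: le_trans (fM _) _; rewrite ltr_pdivlMr // mulrC in xy; apply: le_trans (ltW xy).
  by rewrite ler_wpM2r ?rnorm_ge0 // lerDl.
- apply/seteqP; split=> [x [] |x ->].
    rewrite FE => -[c _ <-] h /=.
    suff -> : c = 0 by rewrite big1 // => i _; rewrite ffunE scale0r.
    by apply/ffunP => i; rewrite ffunE -fsum h.
  by split=> [|i]; [exact: subspace0|exact: f0].
- apply/seteqP; split=> // x _.
  exists (\sum_i [ffun i => f i x] i *: e i); first by rewrite FE; eexists.
  exists (x - \sum_i [ffun i => f i x] i *: e i); last by rewrite addrC subrK.
  move=> i /=; have [h _ _] := fP i.
  by rewrite addrC -scaleN1r h fsum ffunE mulN1r addNr.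
Qed.

Lemma fin_codim_complement A V : subspace A -> subspace V -> V `<=` A ->
  (qdim A V < +oo)%E ->
  exists W, [/\ subspace W, closed W, V `&` W = [set 0] & sum_set V W = A].
Proof.
move=> hA hV VA /qdim_fin[n /(has_qdimP _ hA hV)[e [Ae fe se]]].
exists (span e); split; [exact: subspace_span|exact: closed_span| |].
  apply/seteqP; split=> [x [Vx [c _ cx]] /=|_ ->].
    rewrite -cx in Vx *; rewrite (fe c Vx) big1 // => i _.
    by rewrite ffunE scale0r.
  by split; apply: subspace0 => //; exact: subspace_span.
apply/seteqP; split=> [_ [v Vv [_ [c _ <-] <-]]|x /se[c Vc]].
  by apply: subspaceD => //; [exact: VA|apply: subspace_sum => // i; exact: subspaceZ].
by exists (x - \sum_i c i *: e i) => //; exists (\sum_i c i *: e i); [exists c|rewrite subrK].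
Qed.

End FiniteDimension.
(** * Kato decomposition of an operator with stable iteration *)

Section LinearIterates.
Context {K : fieldType} {X : lmodType K} (T : {linear X -> X}).

Lemma iter_linearP n a u v : iter n T (a *: u + v) = a *: iter n T u + iter n T v.
Proof. by elim: n => //= n ->; rewrite linearP. Qed.

Lemma iter_linearD n u v : iter n T (u + v) = iter n T u + iter n T v.
Proof. by have := iter_linearP n 1 u v; rewrite !scale1r. Qed.

Lemma iter_linear0 n : iter n T 0 = 0.
Proof. by elim: n => //= n ->; rewrite linear0. Qed.

Lemma iter_linearB n u v : iter n T (u - v) = iter n T u - iter n T v.
Proof. by rewrite addrC -scaleN1r iter_linearP scaleN1r addrC. Qed.

Lemma iter_null n m x : (n <= m)%N -> iter n T x = 0 -> iter m T x = 0.
Proof. by move=> /subnK <- h; rewrite iterD h iter_linear0. Qed.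

End LinearIterates.

Section KatoDecomposition.
Context {R : realType} {X : completeNormedModType R[i]} (T : {linear X -> X}).
Context (c : R) (c_ge0 : 0 <= c) (Tc : forall x, rnorm (T x) <= c * rnorm x).
Context (d : nat) (sd : stable_iteration T d).

Let V := sum_set (range T) (null_space (iter d T)).
Let K := range (iter d T) `&` null_space T.

Lemma subspace_range_iter n : subspace (range (iter n T)).
Proof. exact/subspace_image_iter/subspaceT. Qed.

Lemma subspace_null_iter n : subspace (null_space (iter n T)).
Proof.
split; first exact: iter_linear0.
by move=> a u v; rewrite /null_space /preimage /= iter_linearP => -> ->; rewrite scaler0 addr0.
Qed.

Lemma subspace_range_null : subspace V.
Proof. by apply: subspace_add; [exact/subspace_image/subspaceT|exact: subspace_null_iter]. Qed.

Lemma range_sub u : V (T u).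
Proof.
by exists (T u); [exists u|exists 0; [exact: subspace0 (subspace_null_iter d)|rewrite addr0]].
Qed.

(** Dual form of stability: when [T^(r+1) x = 0] with [d <= r], the vector
    [T^r x] lies in [ker T] and in the range of [T^r], hence in that of
    [T^(r+1)], so that [T^r] kills [x - T u] for some [u]. *)
Lemma null_iter_sub r x : iter r T x = 0 -> V x.
Proof.
elim: r x => [|r IH] x.
  by rewrite /= => ->; exact: subspace0 subspace_range_null.
have [rd h|dr h] := ltnP r d.
  exists 0; first exact: subspace0 (subspace_range_iter 1).
  by exists x; rewrite ?add0r //; exact: iter_null rd h.
have : (range (iter r T) `&` null_space T) (iter r T x) by split=> //; exists x.
rewrite -(sd dr) (sd (leqW dr)) => -[[u _ ux] _].
rewrite -(subrK (T u) x); apply: subspaceD; first exact: subspace_range_null.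
  by apply: IH; rewrite iter_linearB -iterSr ux subrr.
exact: range_sub.
Qed.

(** Vectors of [K] have preimages of every order in [T^d X] because [K] is also
    [R(T^(i+d)) /\ N(T)]. *)
Lemma stable_kernel_lift i k : K k -> exists2 m, range (iter d T) m & iter i T m = k.
Proof.
rewrite /K (sd (leq_addl i d)) => -[[u _ <-] _]; exists (iter d T u); first by exists u.
by rewrite iterD.
Qed.

Context (W Z : set X).
Context (hW : subspace W) (VW : V `&` W = [set 0]) (VWT : sum_set V W = setT).
Context (hZ : subspace Z) (KZ : K `&` Z = [set 0]) (KZT : sum_set K Z = setT).

(** Unfolded, [core d] is [W + T W + ... + T^(d-1) W + T^d X]. *)
Fixpoint core n : set X := if n is k.+1 then sum_set W (T @` core k) else setT.

Definition nil_part : set X :=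
  [set x | iter d T x = 0 /\ forall i, (i < d)%N -> Z (iter i T x)].

Lemma subspace_core n : subspace (core n).
Proof. by elim: n => [|n IH] //=; apply: subspace_add => //; exact: subspace_image. Qed.

Lemma subspace_nil_part : subspace nil_part.
Proof.
split.
  by split=> [|i _]; rewrite iter_linear0 //; exact: subspace0.
move=> a u v [u0 uZ] [v0 vZ]; split=> [|i id]; rewrite iter_linearP.
  by rewrite u0 v0 scaler0 addr0.
by apply: hZ.2; [exact: uZ|exact: vZ].
Qed.

Lemma range_core n : range (iter n T) `<=` core n.
Proof.
elim: n => // n IH _ [x _ <-]; exists 0; first exact: subspace0.
by exists (iter n.+1 T x); rewrite ?add0r //; exists (iter n T x) => //; apply: IH; exists x.
Qed.

Lemma core_sub n : core n.+1 `<=` core n.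
Proof.
elim: n => // n IH _ [w Ww [_ [x cx <-] <-]]; exists w => //; exists (T x) => //.
by exists x => //; exact: IH.
Qed.

Lemma core_invariant n : T @` core n `<=` core n.
Proof.
move=> _ [x cx <-]; apply: core_sub; exists 0; first exact: subspace0.
by exists (T x); [exists x|rewrite add0r].
Qed.

Lemma nil_part_invariant : T @` nil_part `<=` nil_part.
Proof.
move=> _ [x [x0 xZ] <-]; split; first by rewrite -iterSr; exact: iter_null x0.
move=> i id; rewrite -iterSr.
have [i1|i1] := ltnP i.+1 d; first exact: xZ.
by rewrite (iter_null i1 x0); exact: subspace0.
Qed.

(** Each [W]-component of a vector of [core n] killed by a power of [T] lies in
    [V], hence vanishes. *)
Lemma core_null n i x : (n + i <= d)%N -> core n x -> iter i.+1 T x = 0 ->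
  range (iter n T) x.
Proof.
elim: n i x => [|n IH] i x; first by exists x.
move=> nid [w Ww [_ [y cy <-] <-]] h.
have w0 : w = 0.
  suff : (V `&` W) w by rewrite VW.
  split=> //; rewrite -(addrK (T y) w); apply: subspaceB; first exact: subspace_range_null.
    exact: null_iter_sub h.
  exact: range_sub.
rewrite w0 add0r in h *.
have y0 : iter i.+2 T y = 0 by rewrite iterSr.
by have [|u _ <-] := IH i.+1 y _ cy y0; [rewrite addnS|exists u].
Qed.

Lemma core_kernel x : core d x -> T x = 0 -> K x.
Proof. by move=> cx Tx; split=> //; apply: (@core_null d 0) => //; rewrite addn0. Qed.

(** Expanding [X = W + T X + ker T^d] once more in the innermost term. *)
Lemma core_step n : core n `<=` sum_set (core n.+1) (iter n T @` null_space (iter d T)).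
Proof.
elim: n => [|n IH] x cx.
  have [_ [_ [u _ <-] [k Nk <-]] [w Ww <-]] : sum_set V W x by rewrite VWT.
  exists (w + T u); first by exists w => //; exists (T u) => //; exists u.
  by exists k; [exists k|rewrite -addrA addrC].
case: cx => w Ww [_ [y /IH[z cz [_ [k Nk <-] <-]] <-] <-].
rewrite linearD addrA; exists (w + T z); first by exists w => //; exists (T z) => //; exists z.
by exists (iter n.+1 T k) => //; exists k.
Qed.

Lemma core_fix : core d `<=` core d.+1.
Proof.
move=> x /core_step[y cy [_ [k Nk <-] <-]].
by rewrite (_ : iter d T k = 0) // addr0.
Qed.

Lemma core_null_full n x : sum_set (core n) (null_space (iter d T)) x.
Proof.
elim: n => [|n [y cy [k Nk <-]]].
  by exists x => //; exists 0; [exact: iter_linear0|rewrite addr0].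
have [z cz [_ [l Nl <-] <-]] := core_step cy; exists z => //.
exists (iter n T l + k); last by rewrite addrA.
apply: subspaceD => //; first exact: subspace_null_iter.
by rewrite /null_space /preimage /= -iterD addnC iterD Nl iter_linear0.
Qed.

(** Correct the values of [T^j y] outside [Z] one at a time, from [j = d - 1]
    down, by vectors of [core d] over elements of [K]. *)
Lemma null_iter_split j y : (j <= d)%N -> iter d T y = 0 ->
  (forall i, (j <= i < d)%N -> Z (iter i T y)) -> sum_set (core d) nil_part y.
Proof.
elim: j y => [|j IH] y jd y0 yZ.
  exists 0; first exact: subspace0 (subspace_core d).
  by exists y; rewrite ?add0r //; split=> // i id; apply: yZ.
have [k Kk [z Zz kz]] : sum_set K Z (iter j T y) by rewrite KZT.
have [m Rm mk] := stable_kernel_lift j Kk.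
have mj : iter j.+1 T m = 0 by rewrite iterS mk; case: Kk.
have [||a ca [b nb ab]] := IH (y - m) (ltnW jd).
- by rewrite iter_linearB y0 (iter_null jd mj) subrr.
- move=> i /andP[ji id]; rewrite iter_linearB.
  move: ji; rewrite leq_eqVlt => /orP[/eqP <-|ji].
    by rewrite mk -kz addrAC subrr add0r.
  by rewrite (iter_null ji mj) subr0; apply: yZ; rewrite ji.
exists (m + a); last by exists b => //; rewrite -addrA ab addrC subrK.
by apply: subspaceD => //; [exact: subspace_core|exact: range_core].
Qed.

Lemma core_nil_sum : sum_set (core d) nil_part = setT.
Proof.
apply/seteqP; split=> // x _; have [y cy [k Nk <-]] := core_null_full d x.
apply: subspaceD; first exact: subspace_add (subspace_core d) subspace_nil_part.
  by exists y => //; exists 0; [exact: subspace0 subspace_nil_part|rewrite addr0].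
by apply: (@null_iter_split d) => // i /andP[h1 h2]; move: (leq_ltn_trans h1 h2); rewrite ltnn.
Qed.

(** If [T^(j+1) x = 0] with [j < d] and [x] is in both parts, then [T^j x] lies in
    [K] (seen from the first part) and in [Z] (seen from the second). *)
Lemma core_nil_disjoint : core d `&` nil_part = [set 0].
Proof.
apply/seteqP; split=> [x [cx [x0 xZ]] /=|_ ->]; last first.
  by split; apply: subspace0; [exact: subspace_core|exact: subspace_nil_part].
have cT i : core d (iter i T x).
  by elim: i => //= i IH; apply: core_invariant; exists (iter i T x).
have : forall j, (j <= d)%N -> iter (d - j) T x = 0.
  elim=> [|j IH] jd; first by rewrite subn0.
  have lt : (d - j.+1 < d)%N by rewrite ltn_subrL (leq_trans _ jd).
  suff : (K `&` Z) (iter (d - j.+1) T x) by rewrite KZ.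
  split; last exact: xZ.
  apply: core_kernel => //; rewrite -iterS subnSK //.
  by apply: IH; exact: ltnW.
by move=> /(_ d (leqnn d)); rewrite subnn.
Qed.

Lemma core_split : sum_set (T @` core d) W = core d /\ T @` core d `&` W = [set 0].
Proof.
split; apply/seteqP; split.
- move=> _ [_ [x cx <-] [w Ww <-]]; apply: core_sub.
  by exists w => //; exists (T x); [exists x|rewrite addrC].
- by move=> x /core_fix[w Ww [y cy <-]]; exists y => //; exists w => //; rewrite addrC.
- move=> _ [[x cx <-] Wx] /=; suff : (V `&` W) (T x) by rewrite VW.
  by split=> //; exact: range_sub.
- move=> _ ->; split; apply: subspace0 => //; exact/subspace_image/subspace_core.
Qed.

(** The inclusion [core d -> X] induces the isomorphism: both quotients are copies
    of [W]. *)
Lemma core_coker : qdim (core d) (T @` core d) = qdim setT V.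
Proof.
have hTc : subspace (T @` core d) by exact/subspace_image/subspace_core.
have hV := subspace_range_null.
have [split_sum split_cap] := core_split.
apply: (qdim_iso (f := idfun)) => //; first exact: subspace_core.
- move=> x cx; split=> [Vx|[y cy <-]].
    have [_ [y cy <-] [w Ww yw]] : sum_set (T @` core d) W x by rewrite split_sum.
    suff w0 : w = 0 by exists y; rewrite // -yw w0 addr0.
    suff : (V `&` W) w by rewrite VW.
    split=> //; have := subspaceB hV Vx (range_sub y).
    by rewrite /= -yw [_ + w]addrC addrK.
  exact: range_sub.
- move=> x _; have [v Vv [w Ww <-]] : sum_set V W x by rewrite VWT.
  exists w; last by rewrite addrK.
  apply: core_sub; exists w => //; exists 0; last by rewrite addr0.
  by exists 0; [exact: subspace0 (subspace_core d)|rewrite linear0].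
Qed.

Context (cW : closed W) (cZ : closed Z).

Lemma iter_bounded n x : rnorm (iter n T x) <= c ^+ n * rnorm x.
Proof.
elim: n => [|n IH]; first by rewrite mul1r.
by apply: le_trans (Tc _) _; rewrite exprS -mulrA ler_wpM2l.
Qed.

Lemma closed_nil_part : closed nil_part.
Proof.
apply/closedP => x hx; split.
  apply: rnorm_small => e e0.
  have c1 : 0 < c ^+ d + 1 by rewrite ltr_wpDl // exprn_ge0.
  have [y [y0 _] xy] := hx _ (divr_gt0 e0 c1).
  have -> : iter d T x = iter d T (x - y) by rewrite iter_linearB y0 subr0.
  apply: le_trans (iter_bounded _ _) _; rewrite ltr_pdivlMr // mulrC in xy.
  by apply: le_trans (ltW xy); rewrite ler_wpM2r ?rnorm_ge0 // lerDl.
move=> i id; move/closedP: cZ; apply => e e0.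
have c1 : 0 < c ^+ i + 1 by rewrite ltr_wpDl // exprn_ge0.
have [y [_ yZ] xy] := hx _ (divr_gt0 e0 c1); exists (iter i T y); first exact: yZ.
rewrite -iter_linearB; apply: le_lt_trans (iter_bounded _ _) _.
rewrite ltr_pdivlMr // mulrC in xy.
by apply: le_lt_trans xy; rewrite ler_wpM2r ?rnorm_ge0 // lerDl.
Qed.

(** This is what makes [core n] an operator range, for which algebraic
    complementation by a closed subspace implies closedness. *)
Lemma core_disc n : exists B, disc B /\ spans B (core n).
Proof.
elim: n => [|n [B [dB sB]]] /=.
  by exists (unit_disc setT); split; [apply: disc_unit|apply: spans_unit].
exists (sum_set (unit_disc W) (T @` B)).
have dT := disc_image c_ge0 Tc dB; have dW := disc_unit hW cW.
split; first exact: disc_sum.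
by apply: spans_sum => //; [exact: spans_unit|exact: spans_image].
Qed.

Lemma closed_core : closed (core d).
Proof.
have [B [dB sB]] := core_disc d.
apply: (closed_summand dB sB (subspace_core d) subspace_nil_part closed_nil_part).
  exact: core_nil_disjoint.
by rewrite core_nil_sum; exact: closedT.
Qed.

Lemma closed_image_core : closed (T @` core d).
Proof.
have [B [dB sB]] := core_disc d; have [ss sc] := core_split.
apply: (closed_summand (disc_image c_ge0 Tc dB) (spans_image T sB) _ hW cW sc).
  exact/subspace_image/subspace_core.
by rewrite ss; exact: closed_core.
Qed.

End KatoDecomposition.
(** * Semi-Fredholm operators without nonzero spectrum *)

Section Shift.
Context {R : realType} {X : normedModType R[i]} (T : {linear X -> X}) (l : R[i]).

Definition shift x := T x - l *: x.

Fact shift_is_linear : linear shift.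
Proof.
move=> a u v; rewrite /shift linearP scalerDr !scalerA [l * a]mulrC -scalerA.
by rewrite scalerBr opprD addrACA.
Qed.

HB.instance Definition _ := GRing.isLinear.Build R[i] X X *:%R shift shift_is_linear.

Lemma shift_iter n x : iter n T (shift x) = shift (iter n T x).
Proof. by elim: n => //= n ->; rewrite /shift linearB linearZ. Qed.

Lemma shift_bounded (c : R) x : (forall x, rnorm (T x) <= c * rnorm x) ->
  rnorm (shift x) <= (c + rnorm l) * rnorm x.
Proof.
move=> Tc; apply: le_trans (rnormD _ _) _; rewrite rnormN rnormZ mulrDl.
exact: lerD.
Qed.

End Shift.

Section InvertibleShifts.
Context {R : realType} {X : completeNormedModType R[i]} (T : {linear X -> X}).
Context (c : R) (c_ge0 : 0 <= c) (Tc : forall x, rnorm (T x) <= c * rnorm x).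
Implicit Types A : set X.

Lemma open_map (f : {linear X -> X}) (M : R) A : 0 <= M ->
  (forall x, rnorm (f x) <= M * rnorm x) -> subspace A -> closed A -> closed (f @` A) ->
  exists2 C : R, 0 < C & forall y, (f @` A) y ->
    exists x, [/\ A x, f x = y & rnorm x <= C * rnorm y].
Proof.
move=> M0 fM hA cA cfA.
have [C C0 hC] := open_mapping (disc_image M0 fM (disc_unit hA cA)) (subspace_image f hA) cfA
  (spans_image f (spans_unit hA)).
exists C => // y /hC[_ [b [Ab b1] <-] yE]; exists (rc (C * rnorm y) *: b); split.
- exact: subspaceZ.
- by rewrite linearZ.
- have Cy : 0 <= C * rnorm y by rewrite mulr_ge0 ?rnorm_ge0 // (ltW C0).
  by rewrite rnormZr ger0_norm // -[leRHS]mulr1; apply: ler_wpM2l.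
Qed.

(** The finite-dimensional complement of [T A] in [A] is closed. *)
Lemma closed_image_coker A : subspace A -> closed A -> T @` A `<=` A ->
  (coker_dim T A < +oo)%E -> closed (T @` A).
Proof.
move=> hA cA TA fA; have hTA := subspace_image T hA.
have [W [hW cW VW VWA]] := fin_codim_complement hA hTA TA fA.
apply: (closed_summand (disc_image c_ge0 Tc (disc_unit hA cA)) (spans_image T (spans_unit hA))
  hTA hW cW VW).
by rewrite VWA.
Qed.

(** [T (T A)] is the image of the subspace [T A + (A /\ ker T)], closed because the
    second term is finite-dimensional, and an open map sends closed sets saturated
    by its kernel to closed sets. *)
Lemma closed_image2_ker A : subspace A -> closed A -> T @` A `<=` A -> closed (T @` A) ->
  (ker_dim T A < +oo)%E -> closed (T @` (T @` A)).
Proof.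
move=> hA cA TA cTA fA; have hTA := subspace_image T hA.
have hK : subspace (A `&` null_space T) by apply: subspaceI => //; exact: subspace_null.
have [C C0 hC] := open_map c_ge0 Tc hA cA cTA.
apply/closedP => y hy.
have [b Ab yE] : (T @` A) y.
  move/closedP: cTA; apply => e e0; have [z Tz yz] := hy e e0.
  by exists z => //; case: Tz => a Ta <-; exists a => //; exact: TA.
have [a Ta [k [Ak Nk] bE]] : sum_set (T @` A) (A `&` null_space T) b.
  have := closed_add_fin_dim hTA cTA hK fA; move/closedP; apply => e e0.
  have [_ [a Ta <-] ya] := hy _ (divr_gt0 e0 C0).
  have Aa := TA _ Ta.
  have [|u [Au uE uC]] := hC (T (b - a)); first by exists (b - a) => //; exact: subspaceB.
  exists (a + (b - a - u)).
    exists a => //; exists (b - a - u) => //; split.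
      by apply: subspaceB => //; exact: subspaceB.
    by rewrite /null_space /preimage /= linearB uE subrr.
  have -> : b - (a + (b - a - u)) = u.
    by rewrite addrA [a + _]addrC subrK subKr.
  apply: le_lt_trans uC _; rewrite linearB yE.
  by rewrite ltr_pdivlMr // mulrC in ya.
exists a => //; rewrite -yE -bE linearD (_ : T k = 0) ?addr0 //.
Qed.

Lemma closed_images A n : subspace A -> closed A -> T @` A `<=` A ->
  (closed (T @` A) /\ (ker_dim T A < +oo)%E) \/ (coker_dim T A < +oo)%E ->
  closed (iter n T @` A).
Proof.
move=> hA cA TA h.
have hAn k := subspace_image_iter T k hA.
have TAn k : T @` (iter k T @` A) `<=` iter k T @` A.
  by rewrite -image_iterS; exact: image_iter_subS.
case: h => [[cTA fA]|fA].
- suff [] : [/\ closed (iter n T @` A), closed (iter n.+1 T @` A) &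
      (ker_dim T (iter n T @` A) < +oo)%E] by [].
  elim: n => [|n [IH1 IH2 IH3]]; first by rewrite image_iterS !image_id.
  rewrite image_iterS in IH2.
  split; rewrite ?image_iterS //; first exact: closed_image2_ker.
  exact: ker_dim_step.
- suff [] : closed (iter n T @` A) /\ (coker_dim T (iter n T @` A) < +oo)%E by [].
  elim: n => [|n [IH1 IH2]]; first by rewrite image_id.
  by rewrite image_iterS; split; [exact: closed_image_coker|exact: coker_dim_step].
Qed.

Context (A : set X) (hA : subspace A) (cA : closed A) (TA : T @` A `<=` A).
Context (shift_inj : forall (l : R[i]) x, l != 0 -> A x -> shift T l x = 0 -> x = 0).
Context (shift_sur : forall (l : R[i]) y, l != 0 -> A y -> exists2 x, A x & shift T l x = y).

(** A bounded bijection of a Banach space has a bounded inverse. *)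
Lemma shift_bounded_below (l : R[i]) : l != 0 ->
  exists2 C : R, 0 < C & forall x, A x -> rnorm x <= C * rnorm (shift T l x).
Proof.
move=> l0.
have sA : shift T l @` A = A.
  apply/seteqP; split=> [_ [x Ax <-]|y /(shift_sur l0)[x Ax <-]]; last by exists x.
  by apply: subspaceB => //; [apply: TA; exists x|exact: subspaceZ].
have cl : 0 <= c + rnorm l by rewrite addr_ge0 ?rnorm_ge0.
have [|C C0 hC] := open_map cl (fun x => shift_bounded l x Tc) hA cA; first by rewrite sA.
exists C => // x Ax; have [|y [Ay yx yC]] := hC (shift T l x); first by exists x.
suff -> : x = y by rewrite yx in yC *.
apply/eqP; rewrite -subr_eq0; apply/eqP/(shift_inj l0); first exact: subspaceB.
by rewrite linearB /= yx subrr.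
Qed.

(** Kernel vectors that lie in every [T^r A] start backward orbits
    [x_0, x_1, ...] of at most geometric growth. For small [l] the partial sums
    of [\sum_k l^k x_k] are almost annihilated by [T - l] while staying close
    to [x_0], so that [x_0 = 0]. *)
Lemma stable_kernel_zero (C : R) (Q : set X) x0 : 0 < C ->
  (forall x, Q x -> exists x', [/\ Q x', T x' = x & rnorm x' <= C * rnorm x]) ->
  Q `<=` A -> Q x0 -> T x0 = 0 -> x0 = 0.
Proof.
move=> C0 lift QA Qx0 Tx0.
have /choice[g gP] : forall x, exists x', Q x -> [/\ Q x', T x' = x & rnorm x' <= C * rnorm x].
  by move=> x; have [/lift[x' h]|nQ] := pselect (Q x); [exists x'|exists 0 => /nQ].
have Qg k : Q (iter k g x0) by elim: k => //= k IH; case: (gP _ IH).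
have [x [xE Qx Tx hx]] : exists x : nat -> X, [/\ x 0%N = x0, forall k, Q (x k),
    forall k, T (x k.+1) = x k & forall k, rnorm (x k.+1) <= C * rnorm (x k)].
  by exists (fun k => iter k g x0); split=> // k; case: (gP _ (Qg k)).
have xC k : rnorm (x k) <= C ^+ k * rnorm x0.
  elim: k => [|k IH]; first by rewrite mul1r xE.
  apply: le_trans (hx k) _.
  by rewrite exprS -mulrA; apply: ler_wpM2l => //; exact: ltW.
(* With this [l], the norm of [l^k x_k] is at most [4^-k] times that of [x_0], so
   the tail of the series has at most half the norm of [x_0]. *)
pose l : R := (4 * C)^-1.
have l0 : 0 < l by rewrite invr_gt0 mulr_gt0.
have lC k : l ^+ k * C ^+ k = (2^-1 ^+ k) * (2^-1 ^+ k).
  rewrite -!exprMn; congr (_ ^+ _).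
  by rewrite /l invfM -mulrA mulVf ?gt_eqF // mulr1; lra.
have lx k : l ^+ k * rnorm (x k) <= 2^-1 ^+ k * 2^-1 ^+ k * rnorm x0.
  by rewrite -lC -mulrA; apply: ler_wpM2l => //; rewrite exprn_ge0 // ltW.
have lx' k (b : R) : 0 <= b -> rnorm (rc (l ^+ k * b) *: x k) =  b * (l ^+ k * rnorm (x k)).
  move=> b0; rewrite rnormZr ger0_norm; first by rewrite mulrAC [RHS]mulrA mulrC mulrA.
  by rewrite mulr_ge0 // exprn_ge0 // ltW.
have TZ a u : T (a *: u) = a *: T u by rewrite linearZ.
pose s n := \sum_(k < n.+1) rc (l ^+ k) *: x k.
have sE n : shift T (rc l) (s n) = - (rc (l ^+ n.+1) *: x n).
  elim: n => [|n IH]; first by rewrite /s big_ord1 /shift expr0 expr1 !scale1r xE Tx0 sub0r.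
  rewrite /s big_ord_recr linearD /= -/(s n) IH /shift TZ Tx scalerA -rmorphM -exprS.
  by rewrite addrA addNr sub0r.
have sA n : A (s n) by apply: subspace_sum => // k; apply: subspaceZ => //; exact: QA.
have s0 n : rnorm (s n - x0) <= (1 - 2^-1 ^+ n) / 2 * rnorm x0.
  elim: n => [|n IH]; first by rewrite /s big_ord1 scale1r xE !subrr rnorm0 !mul0r.
  rewrite /s big_ord_recr /= -/(s n) addrAC; apply: le_trans (rnormD _ _) _.
  have := lx' n.+1 1 ler01; rewrite mulr1 mul1r => ->.
  apply: le_trans (lerD IH (lx n.+1)) _; rewrite -mulrDl ler_wpM2r ?rnorm_ge0 //.
  rewrite exprS; have h0 : 0 <= (2^-1 : R) ^+ n by rewrite exprn_ge0.
  have h1 : (2^-1 : R) ^+ n <= 1 by exact: expr_half_le1.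
  have := ler_wpM2l h0 h1; lra.
have rl0 : rc l != 0 :> R[i] by rewrite fmorph_eq0 gt_eqF.
have [D D0 hD] := shift_bounded_below rl0.
have sS n : rnorm (s n) <= (D * l * rnorm x0) * 2^-1 ^+ n.
  apply: le_trans (hD _ (sA n)) _; rewrite sE rnormN exprSr lx' ?(ltW l0) //.
  rewrite -!mulrA; apply: ler_wpM2l; first exact: ltW.
  apply: ler_wpM2l; first exact: ltW.
  apply: le_trans (lx n) _; rewrite mulrC; apply: ler_wpM2l; first exact: rnorm_ge0.
  by rewrite -[leRHS]mulr1; apply: ler_wpM2l; rewrite ?exprn_ge0 // expr_half_le1.
apply: rnorm_small => e e0.
have e2 : 0 < e / 2 by rewrite divr_gt0.
have [n hn] := half_small (D * l * rnorm x0) e2.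
have h0 : 0 <= (2^-1 : R) ^+ n * rnorm x0 by rewrite mulr_ge0 ?exprn_ge0 ?rnorm_ge0.
have h1 := s0 n; have h2 := le_lt_trans (sS n) hn.
have : rnorm x0 <= rnorm (s n - x0) + rnorm (s n).
  by rewrite -[X in rnorm X <= _](subKr (s n)) addrC -rnormB opprB; apply: rnormD.
lra.
Qed.

(** At the index [m] where the kernels stabilize, kernel vectors belong to all
    the [T^r A], so [stable_kernel_zero] makes [T] injective on [T^m A], hence
    bounded below there as its range is closed. Then [T - l] is bounded below
    uniformly for small [l], and solving [(T - l) x = y] solves [T x = y] up to an
    error of at most half the size of [y]; iterating, [y] is a limit of points of
    the closed range. *)
Lemma semi_Fredholm_bijective :
  (closed (T @` A) /\ (ker_dim T A < +oo)%E) \/ (coker_dim T A < +oo)%E ->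
  exists m, (forall x, (iter m T @` A) x -> T x = 0 -> x = 0) /\
            iter m.+1 T @` A = iter m T @` A.
Proof.
move=> fA.
have cAn n : closed (iter n T @` A) by apply: closed_images.
have hAn n := subspace_image_iter T n hA.
have An n := image_iter_sub TA (leq0n n); rewrite image_id in An.
have [|m hm] := ker_stable hA TA; first by case: fA => [[_ ?]|?]; [left|right].
have cTm : closed (T @` (iter m T @` A)) by rewrite -image_iterS.
have [C C0 hC] := open_map c_ge0 Tc (hAn m) (cAn m) cTm.
rewrite -image_iterS in hC.
have inj x : (iter m T @` A) x -> T x = 0 -> x = 0.
  move=> Ax Tx.
  pose Q : set X := [set x | forall r, (m <= r)%N -> (iter r T @` A) x].
  apply: (@stable_kernel_zero C Q) => //.
  - move=> y Qy; have [|x' [Ax' Tx' hx']] := hC y; first exact: Qy.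
    exists x'; split=> // r mr.
    have := Qy r.+1 (leqW mr); rewrite image_iterS => -[u Au uy].
    rewrite -(subrK u x'); apply: subspaceD => //.
    suff : (iter r T @` A `&` null_space T) (x' - u) by case.
    rewrite (hm r mr); split; last by rewrite /null_space /preimage /= linearB Tx' uy subrr.
    by apply: subspaceB => //; exact: image_iter_sub TA mr _ Au.
  - by move=> y /(_ m (leqnn m))/An.
  - by move=> r mr; have : (iter r T @` A `&` null_space T) x; [rewrite (hm r mr)|case].
exists m; split=> //; apply/seteqP; split; first exact: image_iter_subS.
have below x : (iter m T @` A) x -> rnorm x <= C * rnorm (T x).
  move=> Ax; have [|x' [Ax' Tx' hx']] := hC (T x); first by rewrite image_iterS; exists x.
  suff -> : x = x' by rewrite Tx' in hx' *.
  apply/eqP; rewrite -subr_eq0; apply/eqP/inj; first exact: subspaceB.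
  by rewrite linearB Tx' subrr.
pose l : R := (4 * C)^-1.
have l0 : 0 < l by rewrite invr_gt0 mulr_gt0.
have rl0 : rc l != 0 :> R[i] by rewrite fmorph_eq0 gt_eqF.
(* [|T x|] is at most [|y| + l |x|] and [l |x|] at most [|T x| / 4], which bounds the
   error [l |x|] by [|y| / 3]. *)
have half y : (iter m T @` A) y ->
    exists2 x, (iter m T @` A) x & rnorm (y - T x) <= rnorm y / 2.
  move=> [a Aa <-]; have [b Ab <-] := shift_sur rl0 Aa.
  exists (iter m T b); first by exists b.
  rewrite shift_iter; set x := iter m T b.
  have Ax : (iter m T @` A) x by exists b.
  have -> : shift T (rc l) x - T x = - (rc l *: x) by rewrite /shift addrAC subrr add0r.
  rewrite rnormN rnormZr gtr0_norm //.
  have hx := below x Ax.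
  have lCx : l * rnorm x <= rnorm (T x) / 4.
    rewrite /l invfM -mulrA ler_pdivrMl // mulrCA [X in _ <= X]mulrC.
    rewrite ler_pdivrMl //; apply: le_trans hx _.
    by rewrite [X in _ <= X]mulrA mulrAC mulrC; lra.
  have : rnorm (T x) <= rnorm (shift T (rc l) x) + l * rnorm x.
    apply: le_trans (_ : rnorm (shift T (rc l) x + rc l *: x) <= _).
      by rewrite /shift subrK.
    by apply: le_trans (rnormD _ _) _; rewrite rnormZr gtr0_norm.
  have := rnorm_ge0 (T x); lra.
move=> y Ay; move/closedP: (cAn m.+1); apply => e e0.
have [n hn] := half_small (rnorm y) e0.
suff [x Ax hx] : exists2 x, (iter m T @` A) x & rnorm (y - T x) <= rnorm y * 2^-1 ^+ n.
  exists (T x); last exact: le_lt_trans hx hn.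
  by rewrite image_iterS; exists x.
elim: n {hn} => [|n [x Ax hx]].
  by exists 0; [exact: subspace0|rewrite linear0 subr0 mulr1].
have [|x' Ax' hx'] := half (y - T x).
  apply: subspaceB => //; apply: (image_iter_subS (n := m)) => //.
  by rewrite image_iterS; exists x.
exists (x + x'); first exact: subspaceD.
rewrite linearD opprD addrA; apply: le_trans hx' _; rewrite exprSr mulrA.
by rewrite ler_wpM2r.
Qed.

End InvertibleShifts.
(** * Nilpotent operators, and closedness in a subspace *)

Lemma bounded_rnorm (R : realType) (Y : normedModType R[i]) (S : {linear Y -> Y}) :
  bounded_operator S <->
  exists2 c : R, 0 <= c & forall x, rnorm (S x) <= c * rnorm x.
Proof.
split=> [[M hM]|[c c0 hc]]; last first.
  by exists (rc c) => y; rewrite !rnormE -rmorphM lecR.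
exists `|complex.Re M| => // x; have := hM x.
rewrite !rnormE lecE => /andP[_]; case: M {hM} => a b /=; rewrite mulr0 subr0 => h.
by apply: le_trans h _; apply: ler_wpM2r; [exact: rnorm_ge0|exact: ler_norm].
Qed.

Section Nilpotent.
Context {R : realType} {Y : normedModType R[i]} (S : {linear Y -> Y}).

(** The Neumann series of [(S - l)^-1] truncated at [k] terms; it is the exact
    inverse when [S^k = 0]. *)
Definition neumann (l : R[i]) k y := - \sum_(j < k) l^-1 ^+ j.+1 *: iter j S y.

Fact neumann_is_linear l k : linear (neumann l k).
Proof.
move=> a u v; rewrite /neumann scalerN scaler_sumr -opprD -big_split; congr (- _).
by apply: eq_bigr => j _; rewrite iter_linearP scalerDr !scalerA mulrC.
Qed.

HB.instance Definition _ l k :=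
  GRing.isLinear.Build R[i] Y Y *:%R (neumann l k) (neumann_is_linear l k).

Lemma neumannC l k y : neumann l k (S y) = S (neumann l k y).
Proof.
rewrite /neumann [RHS]linearN; congr (- _).
by rewrite linear_sum; apply: eq_bigr => j _; rewrite linearZ /= -iterS -iterSr.
Qed.

Lemma neumann_shift l k y : l != 0 ->
  S (neumann l k y) - l *: neumann l k y = y - l^-1 ^+ k *: iter k S y.
Proof.
move=> l0; elim: k => [|k IH].
  by rewrite /neumann big_ord0 oppr0 linear0 scaler0 subrr expr0 scale1r subrr.
have -> : neumann l k.+1 y = neumann l k y - l^-1 ^+ k.+1 *: iter k S y.
  by rewrite /neumann big_ord_recr opprD.
have hl : l *: (l^-1 ^+ k.+1 *: iter k S y) = l^-1 ^+ k *: iter k S y.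
  by rewrite scalerA exprS mulrA divff // mul1r.
have hS : S (l^-1 ^+ k.+1 *: iter k S y) = l^-1 ^+ k.+1 *: iter k.+1 S y by rewrite linearZ.
rewrite linearB hS scalerBr hl opprB addrACA [- _ - _]addrC addrACA IH.
by rewrite addrA subrK.
Qed.

Lemma nilpotent_quasi_nilpotent d : bounded_operator S -> (forall y, iter d S y = 0) ->
  quasi_nilpotent S.
Proof.
move=> /bounded_rnorm[c c0 hc] nil.
have [Y0|nY0] := pselect (forall y : Y, y = 0); [by right|left].
apply/seteqP; split=> [l nl|_ ->].
  apply/eqP; apply: contrapT => /negP l0; apply: nl; exists (neumann l d).
  have inv y : S (neumann l d y) - l *: neumann l d y = y.
    by rewrite neumann_shift // nil scaler0 subr0.
  split=> // [|y]; last by rewrite linearB linearZ /= neumannC.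
  apply/bounded_rnorm; exists (\sum_(j < d) rnorm (l^-1 ^+ j.+1) * c ^+ j).
    by apply: sumr_ge0 => j _; rewrite mulr_ge0 ?rnorm_ge0 ?exprn_ge0.
  move=> y; rewrite /= /neumann rnormN mulr_suml.
  have iterc j : rnorm (iter j S y) <= c ^+ j * rnorm y.
    elim: j => [|j IH]; first by rewrite mul1r.
    by apply: le_trans (hc _) _; rewrite exprS -mulrA; apply: ler_wpM2l.
  elim: (d) => [|k IH]; first by rewrite !big_ord0 rnorm0.
  rewrite !big_ord_recr; apply: le_trans (rnormD _ _) (lerD IH _).
  by rewrite rnormZ -mulrA; apply: ler_wpM2l; [exact: rnorm_ge0|exact: iterc].
move=> [B [_ BS _]]; apply: nY0 => y.
have Sinj z : S z = 0 -> z = 0.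
  by move=> Sz; rewrite -(BS z) Sz scale0r subrr linear0.
have := nil y; elim: (d) => [|k IH] //=; by move=> /Sinj.
Qed.

End Nilpotent.

Section ClosedInSubspace.
Context {R : realType} {X : normedModType R[i]} (L : submodClosed X).

Lemma rnorm_val (u v : subspace_of L) : rnorm (u - v) = rnorm (val u - val v).
Proof. by rewrite -raddfB. Qed.

Lemma closed_val (A : set X) : closed A -> closed (val @^-1` A : set (subspace_of L)).
Proof.
move=> /closedP cA; apply/closedP => x hx; apply: cA => e /hx[a Aa xa].
by exists (val a) => //; rewrite -rnorm_val.
Qed.

Lemma closed_of_val (A : set X) : A `<=` [set` L] -> closed [set` L] ->
  closed (val @^-1` A : set (subspace_of L)) -> closed A.
Proof.
move=> AL /closedP cL /closedP cA; apply/closedP => x hx.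
have Lx : x \in L by apply: cL => e /hx[a /AL La xa]; exists a.
apply: (cA (SubspaceOf Lx)) => e /hx[a Aa xa].
by exists (SubspaceOf (AL _ Aa)) => //; rewrite rnorm_val.
Qed.

End ClosedInSubspace.

Section SubspaceOfSet.
Context {K : fieldType} {X : lmodType K}.

Definition set_pred (A : set X) (hA : subspace A) : {pred X} := fun x => `[< A x >].

Fact set_pred_submod_closed A (hA : subspace A) : submod_closed (set_pred hA).
Proof.
split=> [|a u v /asboolP Au /asboolP Av]; apply/asboolP; first exact: subspace0.
exact: hA.2.
Qed.

HB.instance Definition _ A (hA : subspace A) :=
  GRing.isSubmodClosed.Build K X (set_pred hA) (set_pred_submod_closed hA).

Lemma invariant_subspace_of (T : {linear X -> X}) (A : set X) :
  subspace A -> T @` A `<=` A -> exists M : invariant_subspace T, [set` M] = A.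
Proof.
move=> hA TA.
have TA' : {homo T : x / x \in set_pred hA}.
  by move=> x /asboolP Ax; apply/asboolP/TA; exists x.
by exists (InvariantSubspace TA'); apply/seteqP; split=> x; [move/asboolP|move=> ?; apply/asboolP].
Qed.

End SubspaceOfSet.

(** * Existence of the decomposition *)

Section Existence.
Context {R : realType} {X : completeNormedModType R[i]} (T : {linear X -> X}).

Fact iter_is_linear n : linear (iter n T).
Proof. exact: iter_linearP. Qed.

Definition iter_lin n x := iter n T x.
HB.instance Definition _ n := GRing.isLinear.Build R[i] X X *:%R (iter_lin n) (iter_is_linear n).

Lemma range_iterD n m : iter n T @` range (iter m T) = range (iter (n + m) T).
Proof. by rewrite image_comp; apply: eq_imagel => x _ /=; rewrite iterD. Qed.

Lemma range_invariant n : T @` range (iter n T) `<=` range (iter n T).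
Proof. by move=> _ [_ [x _ <-] <-]; exists (T x) => //; rewrite -iterS -iterSr. Qed.

Lemma ker_dim_range_iter n :
  subspace_dim (null_space (restrict_range T n)) = ker_dim T (range (iter n T)).
Proof. by rewrite ker_dim_restrict range_iter_set. Qed.

Lemma coker_dim_range_iter n :
  subspace_codim (range (restrict_range T n)) = coker_dim T (range (iter n T)).
Proof. by rewrite coker_dim_restrict range_iter_set. Qed.

Lemma semi_fin_stable n : semi_fin T (range (iter n T)) -> exists m, stable_iteration T m.
Proof.
move=> fn; have [m hm] := ker_stable (subspace_range_iter T n) (@range_invariant n) fn.
exists (m + n)%N => r mnr.
have nr : (n <= r)%N by apply: leq_trans mnr; exact: leq_addl.
have mr : (m <= r - n)%N by rewrite leq_subRL // addnC.
by have := hm _ mr; rewrite !range_iterD subnK // => ->.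
Qed.

Context (d : nat) (sd : stable_iteration T d).

(** By stability [K] is also [R(T^r) /\ N(T)] for [r = max d n]. *)
Lemma stable_ker_fin n : (ker_dim T (range (iter n T)) < +oo)%E ->
  (qdim (range (iter d T) `&` null_space T) [set 0%R] < +oo)%E.
Proof.
move=> /qdim_fin[k hk].
have hK r : subspace (range (iter r T) `&` null_space T).
  by apply: subspaceI; [exact: subspace_range_iter|exact: subspace_null].
have [||j hj] // := has_qdim_sub (hK n) (hK d) subspace_zero subspace_zero _ _ hk.
  rewrite (sd (leq_maxl d n)); apply: setSI.
  rewrite -(subnK (leq_maxr d n)) -range_iterD => _ [y yn <-].
  by elim: (_ - _)%N => //= i IH; apply: range_invariant; exists (iter i T y).
by rewrite (qdimE (hK d) subspace_zero hj) ltry.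
Qed.

(** For [r >= d] the map [T^r] induces an isomorphism from [X / V] onto
    [R(T^r) / R(T^(r+1))]. *)
Lemma stable_coker_fin n : (coker_dim T (range (iter n T)) < +oo)%E ->
  (qdim setT (sum_set (range T) (null_space (iter d T))) < +oo)%E.
Proof.
move=> fn; have hV := subspace_range_null T d.
have fnk k : (coker_dim T (range (iter (k + n) T)) < +oo)%E.
  elim: k => [//|k IH]; rewrite addSn -[(_).+1]add1n -range_iterD.
  by apply: coker_dim_step => //; [exact: subspace_range_iter|exact: range_invariant].
have -> : qdim setT (sum_set (range T) (null_space (iter d T))) =
    coker_dim T (range (iter (d + n) T)).
  apply: (qdim_iso (f := iter_lin (d + n))) => //.
  - exact: subspace_range_iter.
  - exact/subspace_image/subspace_range_iter.
  - move=> x _; rewrite /= /iter_lin; split=> [[_ [u _ <-] ux]|[_ [u _ <-] [k k0 <-]]].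
      rewrite -(subrK (T u) x); apply: subspaceD => //; last exact: range_sub.
      by apply: (null_iter_sub sd (r := d + n)); rewrite iter_linearB -iterSr -ux subrr.
    exists (iter (d + n) T u); first by exists u.
    by rewrite iter_linearD (iter_null (leq_addr n d) k0) addr0 -iterS -iterSr.
  - move=> _ [x _ <-]; exists x => //; rewrite subrr; apply: subspace0.
    exact/subspace_image/subspace_range_iter.
exact: fnk.
Qed.

Lemma kato_pseudo_decomposition (W Z : set X) : bounded_operator T ->
  let V := sum_set (range T) (null_space (iter d T)) in
  let K := range (iter d T) `&` null_space T in
  subspace W -> closed W -> V `&` W = [set 0] -> sum_set V W = setT ->
  subspace Z -> closed Z -> K `&` Z = [set 0] -> sum_set K Z = setT ->
  (qdim K [set 0%R] < +oo)%E \/ (qdim setT V < +oo)%E ->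
  pseudo_semi_B_Fredholm T.
Proof.
move=> bT V K hW cW VW VWT hZ cZ KZ KZT fin.
have [c c0 Tc] := (bounded_rnorm T).1 bT.
have hM := subspace_core T hW d; have hN := subspace_nil_part T d hZ.
have [M ME] := invariant_subspace_of hM (core_invariant hW (n := d)).
have [N NE] := invariant_subspace_of hN (nil_part_invariant hZ).
have cN := closed_nil_part c0 Tc (d := d) cZ.
have cM := closed_core c0 Tc sd hW VW VWT hZ KZ KZT cW cZ.
exists M, N; split.
- split; rewrite ?ME ?NE //; split; first exact: (core_nil_disjoint sd hW VW hZ KZ).
  exact: (core_nil_sum sd hW VWT hZ KZT).
- case: fin => [fK|fV]; [left; split|right].
  + rewrite range_restrict ME; apply: closed_val.
    exact: (closed_image_core c0 Tc sd hW VW VWT hZ KZ KZT cW cZ).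
  + rewrite ker_dim_restrict ME; have [k hk] := qdim_fin fK.
    have hK : subspace K by apply: subspaceI; [exact: subspace_range_iter|exact: subspace_null].
    have hK' : subspace (core T W d `&` null_space T) by apply: subspaceI => //; exact: subspace_null.
    have [||j hj] // := has_qdim_sub hK hK' subspace_zero subspace_zero _ _ hk.
      by move=> x [cx Tx]; exact: (core_kernel sd VW).
    by rewrite /ker_dim (qdimE hK' subspace_zero hj) ltry.
  + by rewrite /lower_semi_Fredholm coker_dim_restrict ME /coker_dim (core_coker hW VW VWT).
- apply: (nilpotent_quasi_nilpotent (d := d)).
    apply/bounded_rnorm; exists c => // u; exact: Tc.
  move=> u; apply: val_inj.
  have vE k : val (iter k (@Defs.restrict _ _ T N) u) = iter k T (val u).
    by elim: k => //= k <-.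
  have : [set` N] (val u) by exact: valP.
  by rewrite NE vE => -[].
Qed.

End Existence.

(** * Independence of the index *)

Section IndexOfDecomposition.
Context {R : realType} {X : completeNormedModType R[i]} (T : {linear X -> X}).
Context (bT : bounded_operator T).

Lemma quasi_nilpotent_shift (N : invariant_subspace T) (l : R[i]) :
  quasi_nilpotent (@Defs.restrict _ _ T N) -> l != 0 ->
  (forall x, x \in N -> shift T l x = 0 -> x = 0) /\
  (forall y, y \in N -> exists2 x, x \in N & shift T l x = y).
Proof.
move=> qN l0.
have [B [BS SB]] : exists B : subspace_of N -> subspace_of N,
    (B 0 = 0 /\ forall y, B (@Defs.restrict _ _ T N y - l *: y) = y) /\
    forall y, @Defs.restrict _ _ T N (B y) - l *: B y = y.
  case: qN => [spec|triv]; last first.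
    by exists (fun=> 0); split=> [|y]; [split=> // y|]; rewrite [RHS]triv // [LHS]triv.
  have : ~ spectrum (@Defs.restrict _ _ T N) l by rewrite spec => /= /eqP; rewrite (negPf l0).
  move/contrapT => [B [_ BS SB]]; exists B; split=> //; split=> //; exact: linear0.
split=> [x Nx sx|y Ny].
  have := BS.2 (SubspaceOf Nx).
  have -> : @Defs.restrict _ _ T N (SubspaceOf Nx) - l *: SubspaceOf Nx = 0.
    by apply: val_inj; rewrite raddfB /= linearZ /= scalerN; exact: sx.
  by move=> h; have /(congr1 val) := etrans (esym h) BS.1.
exists (val (B (SubspaceOf Ny))); first exact: valP.
by have /(congr1 val) := SB (SubspaceOf Ny); rewrite raddfB /= linearZ /= ?scalerN.
Qed.

(** The index is computed at [p = m + n], where [T] is bijective on [T^p N], so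
    that this summand contributes neither kernel nor cokernel. *)
Lemma index_decomposition (M N : invariant_subspace T) n :
  pseudo_decomposition M N -> closed (range (iter n T)) ->
  semi_Fredholm (restrict_range T n) ->
  fredholm_index (@Defs.restrict _ _ T M) = fredholm_index (restrict_range T n).
Proof.
move=> [[cM cN [MN0 MNT]] fM qN] cR fR.
have [c c0 Tc] := (bounded_rnorm T).1 bT.
have hM := subspace_pred M; have hN := subspace_pred N.
have TM := @subspace_inv _ _ T M; have TN := @subspace_inv _ _ T N.
have hR k := subspace_range_iter T k.
have hMk k := subspace_image_iter T k hM; have hNk k := subspace_image_iter T k hN.
have Mk k : iter k T @` [set` M] `<=` [set` M].
  by have := image_iter_sub TM (leq0n k); rewrite image_id.
have Nk k : iter k T @` [set` N] `<=` [set` N].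
  by have := image_iter_sub TN (leq0n k); rewrite image_id.
have uniq0 a b : a \in M -> b \in N -> a + b \in N -> a = 0.
  move=> Ma Nb Nab; suff : ([set` M] `&` [set` N]) a by rewrite MN0.
  by split=> //; rewrite -(addrK b a); exact: subspaceB hN _ _ Nab Nb.
have rangeE k x : range (iter k T) x -> exists a b,
    [/\ (iter k T @` [set` M]) a, (iter k T @` [set` N]) b & x = a + b].
  move=> [z _ <-]; have [a Ma [b Nb <-]] : sum_set [set` M] [set` N] z by rewrite MNT.
  by exists (iter k T a), (iter k T b); split; [exists a|exists b|rewrite iter_linearD].
have rangeM k : iter k T @` [set` M] `<=` range (iter k T) by apply: image_subset.
have rangeN k : iter k T @` [set` N] `<=` range (iter k T) by apply: image_subset.
have capN k : range (iter k T) `&` [set` N] = iter k T @` [set` N].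
  apply/seteqP; split=> [x [/rangeE[a [b [Ma Nb ->]]] Nab]|x Nx]; last first.
    by split; [exact: rangeN|exact: Nk Nx].
  by rewrite (uniq0 a b) ?add0r //; [exact: Mk Ma|exact: Nk Nb].
have capM k x : range (iter k T) x -> x \in M -> (iter k T @` [set` M]) x.
  move=> /rangeE[a [b [Ma Nb ->]]] Mab.
  have b0 : b = 0.
    suff : ([set` M] `&` [set` N]) b by rewrite MN0.
    split; last exact: Nk Nb.
    have -> : b = (a + b) - a by rewrite addrC addKr.
    exact: subspaceB hM _ _ Mab (Mk _ _ Ma).
  by rewrite b0 addr0.
have imS k (A : set X) : T @` (iter k T @` A) = iter k.+1 T @` A by rewrite image_iterS.
pose A := iter n T @` [set` N].
have TA : T @` A `<=` A by rewrite imS; exact: image_iter_subS.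
have cA : closed A by rewrite /A -capN; exact: closedI.
have hTR : subspace (T @` range (iter n T)) by exact/subspace_image/hR.
have hTA : subspace (T @` A) by exact/subspace_image/hNk.
have hker (B : set X) : subspace B -> subspace (B `&` null_space T).
  by move=> hB; apply: subspaceI => //; exact: subspace_null.
have finA : (closed (T @` A) /\ (ker_dim T A < +oo)%E) \/ (coker_dim T A < +oo)%E.
  case: (fR) => [[cl fk]|fc]; [left; split|right].
  - rewrite imS -capN; apply: closedI => //; rewrite -imS.
    apply: (@closed_of_val _ _ (range_iter_sub T n)).
    + by rewrite range_iter_set; exact: range_invariant.
    + by rewrite range_iter_set.
    + by rewrite -(range_iter_set T n) -range_restrict.
  - move: fk; rewrite ker_dim_range_iter => /qdim_fin[k hk].
    have [||j hj] // := has_qdim_sub (hker _ (hR n)) (hker _ (hNk n))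
      subspace_zero subspace_zero _ _ hk.
      by apply: setSI; exact: rangeN.
    by rewrite /ker_dim (qdimE (hker _ (hNk n)) subspace_zero hj) ltry.
  - move: fc; rewrite /lower_semi_Fredholm coker_dim_range_iter => /qdim_fin[k hk].
    have [|j hj] := @has_qdim_bounded _ _ A (T @` A) k (hNk n) hTA.
      move=> m f Af ff; apply: (has_qdim_free_le (hR n) hTR hk (f := f)).
        by move=> j; apply: rangeN; exact: Af.
      move=> cf Tcf; apply: ff; rewrite imS -capN; split; first by rewrite -imS.
      by apply: (Nk n); apply: (subspace_sum (hNk n)) => j; exact: subspaceZ (hNk n) _ _ (Af j).
    by rewrite /coker_dim (qdimE (hNk n) hTA hj) ltry.
have [m [injm surm]] : exists m, (forall x, (iter m T @` A) x -> T x = 0 -> x = 0) /\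
    iter m.+1 T @` A = iter m T @` A.
  apply: (semi_Fredholm_bijective c0 Tc (hNk n) cA TA) => // l y l0.
    have [inj _] := quasi_nilpotent_shift qN l0.
    by move=> Ay; apply: inj; exact: Nk Ay.
  have [_ sur] := quasi_nilpotent_shift qN l0.
  move=> [x Nx <-]; have [z Nz <-] := sur x Nx.
  by exists (iter n T z); [exists z|rewrite -shift_iter].
pose p := (m + n)%N.
have imD k j (B : set X) : iter k T @` (iter j T @` B) = iter (k + j) T @` B.
  by rewrite image_comp; apply: eq_imagel => x _ /=; rewrite iterD.
rewrite !imD -/p in injm surm.
rewrite !fredholm_index_restrict range_iter_set.
have [_ ->] := index_iter p hM TM (semi_Fredholm_fin fM).
have fRn : semi_fin T (range (iter n T)) by rewrite -(range_iter_set T n); exact: semi_Fredholm_fin.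
have [_ ->] := index_iter m (hR n) (@range_invariant _ _ T n) fRn.
rewrite range_iterD -/p.
have -> : ker_dim T (iter p T @` [set` M]) = ker_dim T (range (iter p T)).
  congr qdim; apply/seteqP; split; first by apply: setSI; exact: rangeM.
  move=> x [Rx Tx]; split=> //; have [a [b [Ma Nb xE]]] := rangeE _ _ Rx.
  have Tb : T b = 0.
    have Tab : T a + T b = 0 by rewrite -linearD -xE.
    have Ta0 : T a = 0.
      apply: (uniq0 _ (T b)); [exact/inv_subP/(Mk p)|exact/inv_subP/(Nk p)|].
      by rewrite Tab rpred0.
    by rewrite -Tab Ta0 add0r.
  by rewrite xE (injm b Nb Tb) addr0.
suff -> : coker_dim T (iter p T @` [set` M]) = coker_dim T (range (iter p T)) by [].
apply: (qdim_iso (f := idfun)) => //; [exact: subspace_image|exact: subspace_image|exact: rangeM| |].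
- move=> x Mx; split=> [|[y My <-]]; last by exists y => //; exact: rangeM.
  by rewrite !imS => Rx; apply: capM => //; exact: Mk Mx.
- move=> x Rx; have [a [b [Ma Nb ->]]] := rangeE _ _ Rx; exists a => //.
  have -> : a + b - idfun a = b by rewrite addrAC subrr add0r.
  move: Nb; rewrite -surm => -[z _ <-].
  by exists (iter p T z); [exists z|].
Qed.

End IndexOfDecomposition.

Theorem corollary2p24 (R : realType) (X : completeNormedModType R[i])
    (T : {linear X -> X}) :
  subspace_dim [set: X] = +oo%E -> bounded_operator T ->
  (* dis T is finite as soon as T is semi-B-Fredholm, so the default value 0
     is never used *)
  let d := odflt 0%N (dis T) in
  (upper_semi_B_Fredholm T /\
     complemented (sum_set (range T) (null_space (iter d T)))) \/
  (lower_semi_B_Fredholm T /\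
     complemented (range (iter d T) `&` null_space T)) ->
  pseudo_semi_B_Fredholm T /\
  forall n : nat, closed (range (iter n T)) ->
    semi_Fredholm (restrict_range T n) ->
    has_pseudo_index T (fredholm_index (restrict_range T n)).
Proof.
move=> _ bT d h; split; last first.
  by move=> n cR fR M N MN; exact: (index_decomposition bT MN).
case: h => [[[n [_ [_ fn]]] [W [cW [VW VWT]]]]|[[n [_ fn]] [Z [cZ [KZ KZT]]]]].
- rewrite ker_dim_range_iter in fn.
  have sd : stable_iteration T d by apply/dis_stable/(semi_fin_stable (n := n)); left.
  have fK := stable_ker_fin sd fn.
  have hK : subspace (range (iter d T) `&` null_space T).
    by apply: subspaceI; [exact: subspace_range_iter|exact: subspace_null].
  have [Z [hZ cZ KZ KZT]] := fin_dim_complement hK fK.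
  apply: (kato_pseudo_decomposition sd bT (subspace_pred W) cW VW VWT hZ cZ KZ KZT).
  by left.
- rewrite /lower_semi_Fredholm coker_dim_range_iter in fn.
  have sd : stable_iteration T d by apply/dis_stable/(semi_fin_stable (n := n)); right.
  have fV := stable_coker_fin sd fn.
  have [W [hW cW VW VWT]] :=
    fin_codim_complement subspaceT (subspace_range_null T d) (@subsetT _ _) fV.
  apply: (kato_pseudo_decomposition sd bT hW cW VW VWT (subspace_pred Z) cZ KZ KZT).
  by right.
Qed.
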